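(* Let $0\leq p<1/2$. Almost surely, simple random walk on $\mathsf{UIHPQ}_p$ is recurrent.
   Context: ''Almost surely'' refers to the randomness of the map: for almost every realization of the infinite graph, nearest-neighbour simple random walk on it is recurrent. Definition of $\mathsf{UIHPQ}_p$, $p\in[0,1/2]$. Let $\mu_p(k)=p^k(1-p)$, $k\ge 0$. Let $(\mathsf t_i)_{i\in\mathbb Z}$ be independent Galton-Watson plane trees with offspring law $\mu_p$. Given the trees, put on each edge an independent uniform variable in $\{-1,0,1\}$ and let the label $\mathfrak l(u)$ of a vertex $u$ be the sum of the variables along the path from the root of its tree to $u$ (roots have label $0$). Independently, let $\mathsf b=(\mathsf b(i))_{i\in\mathbb Z}$ be a two-sided simple symmetric random walk with $\mathsf b(0)=0$. Call $i$ a down-step if $\mathsf b(i+1)=\mathsf b(i)-1$. View $\mathbb Z$ as the horizontal line; graft $\mathsf t_0,\mathsf t_1,\dots$ in the upper half-plane on the successive down-steps in $\mathbb Z_{\ge 0}$ (in increasing order) and $\mathsf t_{-1},\mathsf t_{-2},\dots$ on the successive down-steps in $\mathbb Z_{<0}$ (in decreasing order). A vertex $u$ of a tree grafted at $i$ receives the shifted label $\mathfrak l(u)+\mathsf b(i)$. Let $(\mathfrak f(j))_{j\in\mathbb Z}$ be the bi-infinite sequence of vertices (corners) obtained by concatenating from left to right the contour explorations of the trees $\dots,\mathsf t_{-1},\mathsf t_0,\mathsf t_1,\dots$ (a tree with $m$ edges contributes $2m+1$ terms), with $\mathfrak f(0)$ the first visit of the root of $\mathsf t_0$; let $L(j)$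 be the shifted label of $\mathfrak f(j)$. The successor of $j$ is the smallest $k>j$ with $L(k)=L(j)-1$. Draw, without crossings, for each $j\in\mathbb Z$ an arc from $\mathfrak f(j)$ to $\mathfrak f(k)$ with $k$ the successor of $j$. The resulting infinite planar map has vertex set $\bigcup_i V(\mathsf t_i)$ and edge set these arcs (line $\mathbb Z$ and tree edges are erased). Its boundary edges are in order-preserving correspondence with the edges $\{i,i+1\}$ of $\mathbb Z$: if $\varphi(i)$ denotes the vertex at the first corner with shifted label $\mathsf b(i)$ encountered in the contour from the beginning of the first tree grafted at a down-step $\ge i$, the edge $\{i,i+1\}$ corresponds to the boundary edge from $\varphi(i)$ to $\varphi(i+1)$. The root edge is the one corresponding to $\{0,1\}$, oriented so that the outer face lies to its right (from $\varphi(0)$ to $\varphi(1)$). $\mathsf{UIHPQ}_p$ is the resulting random infinite rooted quadrangulation with an infinite boundary. *)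

(* Defs.v *)
From HB Require Import structures.
From mathcomp Require Import all_boot all_order all_algebra finmap.
From mathcomp Require Import all_classical all_reals all_analysis.

Set Implicit Arguments.
Unset Strict Implicit.
Unset Printing Implicit Defensive.

Import Order.TTheory GRing.Theory Num.Theory.
Local Open Scope classical_set_scope.
Local Open Scope ring_scope.

(* Finite plane trees: a tree is the ordered sequence of the subtrees hanging
   from the children of its root.  Vertices are Ulam-Harris words in seq nat:
   [::] is the root and c :: u is the vertex u of the c-th subtree. *)
Inductive ptree := PNode of seq ptree.

Fixpoint contour (t : ptree) : seq (seq nat) :=
  let: PNode s := t in
  [::] :: (fix visit (c : nat) (s : seq ptree) : seq (seq nat) :=
             if s is t' :: s' then
               map (cons c) (contour t') ++ [::] :: visit c.+1 s'
             else [::]) 0%N s.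

Definition ptree_vertices (t : ptree) : set (seq nat) :=
  [set u | u \in contour t].

(* The product over the vertices u of t of mu (number of children of u). *)
Fixpoint gw_weight (R : realType) (mu : nat -> R) (t : ptree) : R :=
  let: PNode s := t in
  mu (size s) * foldr (fun t' w => gw_weight mu t' * w) 1 s.

(* [mu p] has mean p / (1 - p), so a Galton-Watson tree with this offspring law
   is almost surely finite for p <= 1/2, and its law is then the probability
   with mass function [gw_weight (mu p)] on finite plane trees. *)
Definition mu (R : realType) (p : R) (k : nat) : R := p ^+ k * (1 - p).

(* For T countable, this is measurability for the discrete sigma-algebra. *)
Definition discrete_rv (d : measure_display) (Omega : measurableType d)
    (T : Type) (X : Omega -> T) : Prop :=
  forall B : set T, measurable (X @^-1` B).

Definition events_of (Omega T : Type) (X : Omega -> T) : set (set Omega) :=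
  [set X @^-1` B | B in [set: set T]].

Definition mutually_independent (R : realType) (d : measure_display)
    (Omega : measurableType d) (P : probability Omega R)
    (I : choiceType) (F : I -> set (set Omega)) : Prop :=
  forall (J : {fset I}) (A : I -> set Omega),
    (forall i, i \in J -> F i (A i)) ->
    P (\bigcap_(i in [set` J]) A i) = (\prod_(i <- J) P (A i))%E.

(* [xi i u], for u <> [::], is the displacement along the edge of the i-th tree
   between u and its parent; it is defined for every word u, independently of
   the trees, but only read at the vertices u of the i-th tree. *)
Definition encoding_events (Omega : Type) (t : int -> Omega -> ptree)
    (xi : int -> seq nat -> Omega -> int) (b : int -> Omega -> int)
    (k : int + int * seq nat + int) : set (set Omega) :=
  match k with
  | inl (inl i) => events_of (t i)
  | inl (inr (i, u)) => events_of (xi i u)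
  | inr i => events_of (fun w => b (i + 1) w - b i w)
  end.

Record uihpq_encoding (R : realType) (p : R) (d : measure_display)
    (Omega : measurableType d) (P : probability Omega R)
    (t : int -> Omega -> ptree) (xi : int -> seq nat -> Omega -> int)
    (b : int -> Omega -> int) : Prop := UihpqEncoding {
  tree_rv : forall i, discrete_rv (t i);
  tree_law : forall i (T : ptree),
    P [set w | t i w = T] = (gw_weight (mu p) T)%:E;
  disp_rv : forall i u, discrete_rv (xi i u);
  disp_law : forall i u (x : int), x \in [:: -1; 0; 1] ->
    P [set w | xi i u w = x] = (3^-1)%:E;
  walk_rv : forall i, discrete_rv (b i);
  walk0 : forall w, b 0 w = 0;
  walk_law : forall i (x : int), x \in [:: -1; 1] ->
    P [set w | b (i + 1) w - b i w = x] = (2^-1)%:E;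
  encoding_indep : mutually_independent P (encoding_events t xi b)
}.

Record multigraph (V E : Type) := Multigraph {
  vertices : set V;
  edges : set E;
  tail : E -> V;
  head : E -> V
}.

Section Construction.
Variables (t : int -> ptree) (xi : int -> seq nat -> int) (b : int -> int).

Definition down_step (i : int) : bool := b (i + 1) == b i - 1.

(* The index of the tree grafted at the down-step i: 0, 1, ... from left to
   right on i >= 0 and -1, -2, ... from right to left on i < 0.  Recall that
   Negz k is -(k + 1). *)
Definition graft_index (i : int) : int :=
  match i with
  | Posz n => Posz (\sum_(k < n) down_step (Posz k))%N
  | Negz n => - Posz (\sum_(k < n.+1) down_step (Negz k))%N
  end.

Definition graft_site (m : int) : int :=
  xget 0 [set i | down_step i /\ graft_index i = m].

(* The vertex (m, u) is the vertex u of the m-th tree. *)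
Definition tree_contour (m : int) : seq (int * seq nat) :=
  [seq (m, u) | u <- contour (t m)].

(* The bi-infinite concatenation of the contours.  Every contour is nonempty, so
   the first n + 1 contours in either direction determine the term of rank n. *)
Definition corner (j : int) : int * seq nat :=
  match j with
  | Posz n => nth (0, [::])
      (flatten [seq tree_contour (Posz k) | k <- iota 0 n.+1]) n
  | Negz n => nth (0, [::])
      (flatten [seq rev (tree_contour (Negz k)) | k <- iota 0 n.+1]) n
  end.

Definition tree_label (m : int) (u : seq nat) : int :=
  \sum_(k < size u) xi m (take k.+1 u).

Definition shifted_label (v : int * seq nat) : int :=
  tree_label v.1 v.2 + b (graft_site v.1).

Definition corner_label (j : int) : int := shifted_label (corner j).

Definition is_successor (j k : int) : Prop :=
  [/\ j < k, corner_label k = corner_label j - 1 &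
      forall i, j < i -> i < k -> corner_label i != corner_label j - 1].

Definition successor (j : int) : int := xget j (is_successor j).

(* The arcs are indexed by the corners they start from, so that multiple edges
   are kept.  The embedding in the plane and the root edge are not recorded: the
   random walk depends on neither, and recurrence is asked from every vertex. *)
Definition uihpq : multigraph (int * seq nat) int := {|
  vertices := [set v | ptree_vertices (t v.1) v.2];
  edges := [set j | exists k, is_successor j k];
  tail := corner;
  head := fun j => corner (successor j)
|}.

End Construction.

Section RandomWalk.
Variables (V : Type) (E : choiceType) (G : multigraph V E).

(* Oriented edges: (e, true) runs from tail to head, (e, false) backwards. *)
Definition dart_from (x : E * bool) : V :=
  if x.2 then tail G x.1 else head G x.1.

Definition dart_to (x : E * bool) : V :=
  if x.2 then head G x.1 else tail G x.1.

Definition darts_at (u : V) : set (E * bool) :=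
  [set x | edges G x.1 /\ dart_from x = u].

Definition darts_between (u v : V) : set (E * bool) :=
  [set x | darts_at u x /\ dart_to x = v].

Definition srw_step (R : realType) (u v : V) : R :=
  (#|` fset_set (darts_between u v)|)%:R / (#|` fset_set (darts_at u)|)%:R.

(* [fset_set] is only meaningful on finite sets: [srw_step] is a transition
   kernel under the following condition. *)
Definition srw_well_defined : Prop :=
  forall v, vertices G v -> finite_set (darts_at v) /\ darts_at v !=set0.

Definition is_srw (R : realType) (d : measure_display)
    (Omega : measurableType d) (P : probability Omega R)
    (v : V) (X : nat -> Omega -> V) : Prop :=
  (forall n, discrete_rv (X n)) /\
  forall (n : nat) (x : nat -> V),
    P [set w | forall k, (k <= n)%N -> X k w = x k] =
    ((`[< x 0%N = v >])%:R * \prod_(k < n) srw_step R (x k) (x k.+1))%:E.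

Definition srw_recurrent (R : realType) : Prop :=
  srw_well_defined /\
  forall v, vertices G v ->
  forall (d : measure_display) (Omega : measurableType d)
    (P : probability Omega R) (X : nat -> Omega -> V),
    is_srw P v X -> {ae P, forall w, exists n, X n.+1 w = v}.

End RandomWalk.

(* Main.v *)
Require Import Defs.
From HB Require Import structures.
From mathcomp Require Import all_boot all_order all_algebra finmap.
From mathcomp Require Import all_classical all_reals all_analysis.
From mathcomp Require Import zify ring lra.

Set Implicit Arguments.
Unset Strict Implicit.
Unset Printing Implicit Defensive.

Import Order.TTheory GRing.Theory Num.Theory.
Import numFieldNormedType.Exports.
Local Open Scope classical_set_scope.
Local Open Scope ring_scope.

(** The walk is recurrent because the map has infinitely many bridges, in the sense of
    graph theory, that separate any given vertex from infinity.

    Fix a level [l] and look at the stretch of the line on which the walk [b] makes an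
    excursion above [l] around the origin: [b lo = b hi = l] and [b > l] in between.
    Suppose that the tree grafted at the final step, from [l + 1] to [l], is a single
    vertex, and that all other trees of the stretch are too small for their labels to
    go below [l + 2] ([is_bridge]).  Labels decrease by at most one along the contour
    ([label_skip_free]).  Hence the successor of a corner of the stretch stays in the
    stretch, except for the last corner, and no arc enters the stretch from the left
    ([bridge_exit], [bridge_no_entry]).  The vertices of the stretch are thus joined to
    the rest of the map by a single edge.

    A graph in which every finite set of vertices lies in a finite set with a single
    boundary edge is recurrent ([one_exit_recurrent]).  Indeed the probability of never
    coming back to [v] is a potential, harmonic off [v], whose gradient carries the same
    current [C] through all these edges; its total energy, at least [C ^+ 2] per edge,
    is bounded by summation by parts, so that [C = 0].

    It remains to find infinitely many bridges.  For [p < 2^-1], trees have [n] edges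
    with probability at most [rho ^+ n], [rho < 1] ([tree_edges_law_le]), so a tree
    grafted at height [h] above [l] is too large with probability exponentially small in
    [h].  A simple random walk killed at height [h] with such a probability reaches
    height [0] alive with a probability that is bounded below uniformly in its
    starting point ([hit_lower]).  Exploring the encoding to the left and to the
    right, the trees met are fresh and independent of the past ([walk_state]).
    Whatever has been explored, a bridge that surrounds it therefore appears with
    probability at least [c > 0], up to an arbitrarily small error due to the trees
    explored already ([bridge_stage]), and almost surely this happens infinitely often
    ([no_bridge_negligible]). *)

(** * Recurrence of graphs with one-edge cuts *)

Section OneEdgeCuts.
Variables (R : realType) (V E : choiceType) (G : multigraph V E).

Local Notation darts u := (fset_set (darts_at G u)).

Let deg u : R := (#|` darts u|)%:R.

(** The probability that the walk started at [u] makes [n] steps without being at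
    [v] at a positive time. *)
Fixpoint avoidance (v : V) (n : nat) (u : V) : R :=
  if n is n'.+1 then
    (deg u)^-1 * \sum_(x <- darts u)
      (dart_to G x != v)%:R * avoidance v n' (dart_to G x)
  else 1.

Lemma avoidance_ge0 v n u : 0 <= avoidance v n u.
Proof.
elim: n u => [|n IH] u //=.
by rewrite mulr_ge0 ?invr_ge0 ?ler0n// sumr_ge0// => x _; rewrite mulr_ge0.
Qed.

Lemma avoidanceS v n u : avoidance v n.+1 u <= avoidance v n u.
Proof.
elim: n u => [|n IH] u /=.
  have [->|d0] := eqVneq (deg u) 0; first by rewrite invr0 mul0r.
  rewrite ler_pdivrMl ?lt_def ?d0 ?ler0n// mulr1 /deg card_fset_sum1 natr_sum.
  by apply: ler_sum => x _; rewrite mulr1; case: (_ != _).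
rewrite ler_wpM2l ?invr_ge0 ?ler0n//; apply: ler_sum => x _.
by rewrite ler_wpM2l// IH.
Qed.

Definition escape (v u : V) : R := limn (avoidance v ^~ u).

Lemma is_cvg_avoidance v u : cvgn (avoidance v ^~ u).
Proof.
apply: nonincreasing_is_cvgn.
  by apply/nonincreasing_seqP => n; apply: avoidanceS.
by exists 0 => _ [n _ <-]; apply: avoidance_ge0.
Qed.

Lemma cvg_avoidance v u : avoidance v n u @[n --> \oo] --> escape v u.
Proof. exact: is_cvg_avoidance. Qed.

Lemma escape_ge0 v u : 0 <= escape v u.
Proof.
apply: limr_ge; first exact: is_cvg_avoidance.
by apply: nearW => n; exact: avoidance_ge0.
Qed.

Lemma escape_le v n u : escape v u <= avoidance v n u.
Proof.
apply: nonincreasing_cvgn_ge; last exact: is_cvg_avoidance.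
by apply/nonincreasing_seqP => k; apply: avoidanceS.
Qed.

Lemma cvg_sum_seq (I : Type) (r : seq I) (F : I -> nat -> R) (l : I -> R) :
  (forall i, F i n @[n --> \oo] --> l i) ->
  (\sum_(i <- r) F i n) @[n --> \oo] --> \sum_(i <- r) l i.
Proof.
move=> Fl; elim: r => [|i r IH].
  rewrite big_nil; under eq_fun do rewrite big_nil; exact: cvg_cst.
by rewrite big_cons; under eq_fun do rewrite big_cons; apply: cvgD.
Qed.

Lemma escapeE v u : deg u != 0 ->
  deg u * escape v u =
  \sum_(x <- darts u) (dart_to G x != v)%:R * escape v (dart_to G x).
Proof.
move=> d0; apply: (mulfI (invr_neq0 d0)); rewrite mulKf//.
have := @cvg_avoidance v u; rewrite -cvg_shiftS => /cvg_lim <- //.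
apply: cvg_lim => //=; apply: cvgMr; apply: cvg_sum_seq => x; apply: cvgMr.
exact: cvg_avoidance.
Qed.

Hypothesis wd : srw_well_defined G.
Hypothesis edge_ends : forall e, edges G e ->
  vertices G (Defs.tail G e) /\ vertices G (Defs.head G e).

Lemma deg_neq0 u : vertices G u -> deg u != 0.
Proof.
move=> /wd [fin [x ux]]; rewrite pnatr_eq0 cardfs_eq0; apply/eqP => d0.
by have := in_fset_set fin x; rewrite d0 inE => /esym/negP[]; rewrite inE.
Qed.

(** The probability of never hitting [v]; the factor grounds it at [v], where [escape]
    is instead the probability of never coming back. *)
Definition potential v u : R := (u != v)%:R * escape v u.

Lemma potential_le1 v u : potential v u <= 1.
Proof.
rewrite /potential; case: (_ != _); rewrite (mul1r, mul0r)//.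
exact: (@escape_le v 0).
Qed.

(** One-step analysis makes the potential harmonic off [v]; at [v] its Laplacian is
    the escape current, which recurrence at [v] requires to vanish. *)
Lemma potential_laplacian v u : vertices G u ->
  \sum_(x <- darts u) (potential v (dart_to G x) - potential v u) =
  (u == v)%:R * (deg v * escape v v).
Proof.
move=> Gu; rewrite sumrB -escapeE ?deg_neq0//.
rewrite big_const_seq count_predT iter_addr_0 -[X in _ - X]mulr_natl.
rewrite -/(deg u) /potential.
by case: eqVneq => [->|]; rewrite ?mul0r ?mul1r ?mulr0 ?subr0 ?subrr.
Qed.

(** Since every edge carries both orientations, a single outgoing dart means that a
    single edge joins [K] to its complement. *)
Definition one_exit (K : {fset V}) (d : E * bool) : Prop :=
  [/\ forall u, u \in K -> vertices G u,
      edges G d.1, dart_from G d \in K, dart_to G d \notin K &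
      forall x, edges G x.1 -> dart_from G x \in K -> dart_to G x \notin K ->
        x = d].

Definition inner_darts (K : {fset V}) : {fset E * bool} :=
  fset_set [set x | [/\ edges G x.1, dart_from G x \in K & dart_to G x \in K]].

Definition dart_rev (x : E * bool) := (x.1, ~~ x.2).

Lemma dart_from_rev x : dart_from G (dart_rev x) = dart_to G x.
Proof. by case: x => e []. Qed.

Lemma dart_to_rev x : dart_to G (dart_rev x) = dart_from G x.
Proof. by case: x => e []. Qed.

Lemma dart_revK : involutive dart_rev.
Proof. by case=> e b; rewrite /dart_rev/= negbK. Qed.

Lemma vertices_to x : edges G x.1 -> vertices G (dart_to G x).
Proof. by case: x => e [] /edge_ends[]. Qed.

Lemma in_darts u x : vertices G u ->
  (x \in darts u) = `[< edges G x.1 /\ dart_from G x = u >].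
Proof. by move=> /wd[fin _]; rewrite in_fset_set// inE; apply/asboolP/asboolP. Qed.

Lemma finite_darts_from (K : {fset V}) : (forall u, u \in K -> vertices G u) ->
  finite_set [set x | edges G x.1 /\ dart_from G x \in K].
Proof.
move=> KG; apply: (@sub_finite_set _ _ (\bigcup_(u in [set` K]) darts_at G u)).
  by move=> x [ex xK]; exists (dart_from G x).
by apply: bigcup_finite => // u /KG/wd[].
Qed.

Lemma in_inner_darts (K : {fset V}) x : (forall u, u \in K -> vertices G u) ->
  (x \in inner_darts K) =
  `[< [/\ edges G x.1, dart_from G x \in K & dart_to G x \in K] >].
Proof.
move=> KG; rewrite in_fset_set ?inE; first by apply/asboolP/asboolP.
by apply: sub_finite_set (finite_darts_from KG) => y [].
Qed.

(** Discrete Green formula: the outgoing dart is the whole boundary, and the inner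
    darts come in opposite pairs. *)
Lemma sum_darts_from K (d : E * bool) (F : E * bool -> R) : one_exit K d ->
  \sum_(u <- K) \sum_(x <- darts u) F x =
  F d + \sum_(x <- inner_darts K) F x.
Proof.
move=> [KG ed fd td dU].
pose D := fset_set [set x | edges G x.1 /\ dart_from G x \in K].
have inD x : (x \in D) = `[< edges G x.1 /\ dart_from G x \in K >].
  rewrite in_fset_set ?inE; first by apply/asboolP/asboolP.
  exact: finite_darts_from.
transitivity (\sum_(x <- D) F x).
  transitivity (\sum_(u <- K) \sum_(x <- D | dart_from G x == u) F x).
    apply: eq_big_seq => u uK.
    suff -> : darts u = [fset x in D | dart_from G x == u]%fset.
      by rewrite -big_fset_condE.
    apply/fsetP => x; rewrite !inE/= inD in_darts; last exact: KG.
    apply/asboolP/andP => [[ex xu]|[/asboolP[ex _] /eqP->]]; last by [].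
    by rewrite xu eqxx; split => //; apply/asboolP.
  rewrite (exchange_big_dep predT)//=; apply: eq_big_seq => x.
  rewrite inD => /asboolP[_ xK].
  rewrite big_mkcond (big_fsetD1 (dart_from G x))//= eqxx big_seq big1 ?addr0//.
  by move=> u; rewrite !inE => /andP[/negPf]; rewrite eq_sym => ->.
rewrite (big_fsetD1 d)/=; last by rewrite inD; apply/asboolP.
suff -> : (D `\ d)%fset = inner_darts K by [].
apply/fsetP => x; rewrite !inE inD in_inner_darts//; apply/andP/asboolP.
  move=> [/eqP xd /asboolP[ex fx]]; split => //; apply: contrapT => /negP tx.
  exact: xd (dU _ _ _ _).
move=> [ex fx tx]; split; last exact/asboolP.
by apply: contraNneq td => <-.
Qed.

Lemma sum_inner_darts_rev (K : {fset V}) (F : E * bool -> R) :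
  (forall u, u \in K -> vertices G u) ->
  \sum_(x <- inner_darts K) F x = \sum_(x <- inner_darts K) F (dart_rev x).
Proof.
move=> KG; rewrite -[RHS](big_map dart_rev predT); apply: perm_big.
apply: uniq_perm; rewrite ?fset_uniq//.
  by rewrite map_inj_uniq ?fset_uniq//; apply: inv_inj dart_revK.
have revin x : x \in inner_darts K -> dart_rev x \in inner_darts K.
  rewrite !in_inner_darts// => /asboolP[ex fx tx]; apply/asboolP.
  by rewrite dart_from_rev dart_to_rev.
move=> x; apply/idP/mapP => [xK|[y yK ->]]; last exact: revin.
by exists (dart_rev x); [exact: revin|rewrite dart_revK].
Qed.

Definition neighbours u : {fset V} := [fset dart_to G x | x in darts u]%fset.

Lemma vertices_neighbour u w : vertices G u -> w \in neighbours u ->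
  vertices G w.
Proof.
by move=> Gu /imfsetP[x /=]; rewrite in_darts// => /asboolP[/vertices_to ? _] ->.
Qed.

Lemma sum_srw_step u (F : V -> R) : vertices G u ->
  \sum_(w <- neighbours u) srw_step G R u w * F w =
  (deg u)^-1 * \sum_(x <- darts u) F (dart_to G x).
Proof.
move=> Gu; rewrite (partition_big_imfset _ (dart_to G))/= mulr_sumr.
apply: eq_bigr => w _; rewrite /srw_step -/(deg u) mulrAC mulrC; congr (_ * _).
have -> : fset_set (darts_between G u w) =
    [fset x in darts u | dart_to G x == w]%fset.
  apply/fsetP => x; have [fin _] := wd Gu.
  rewrite !inE/= !in_fset_set//; last by apply: sub_finite_set fin => y [].
  apply/idP/andP => [/set_mem[/mem_set ? ->]|[/set_mem ? /eqP ?]] //.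
  exact/mem_set.
rewrite mulrC card_fset_sum1 natr_sum mulr_sumr -big_fset_condE.
by apply: eq_bigr => x /eqP <-; rewrite mulr1.
Qed.

Section Walk.
Variables (d : measure_display) (Omega : measurableType d).
Variables (P : probability Omega R) (v : V) (X : nat -> Omega -> V).
Hypothesis srwX : is_srw G P v X.

Let path_event (n : nat) (x : nat -> V) : set Omega :=
  [set w | forall k, (k <= n)%N -> X k w = x k].

Let no_visit (n m : nat) : set Omega :=
  [set w | forall k, (n < k <= n + m)%N -> X k w != v].

Let extend (n : nat) (x : nat -> V) (u : V) (k : nat) : V :=
  if (k <= n)%N then x k else u.

Let measurable_eqX k u : measurable [set w | X k w = u].
Proof. exact: srwX.1 k [set u]. Qed.

Let measurable_path n x : measurable (path_event n x).
Proof.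
have -> : path_event n x = \bigcap_(k in `I_n.+1) [set w | X k w = x k] by [].
by apply: bigcap_measurableType => k _.
Qed.

Let measurable_no_visit n m : measurable (no_visit n m).
Proof.
have -> : no_visit n m =
    \bigcap_(k in [set k | (n < k <= n + m)%N]) ~` [set w | X k w = v].
  by apply/seteqP; split => w H k /H => [/eqP//|]; move=> /eqP.
by apply: bigcap_measurableType => k _; apply: measurableC.
Qed.

Let path_extend n x u :
  path_event n.+1 (extend n x u) = path_event n x `&` [set w | X n.+1 w = u].
Proof.
apply/seteqP; split => [w H|w [H /= Xu] k].
  split => [k kn|]/=; last by rewrite (H _ (leqnn _)) /extend ltnn.
  by rewrite (H _ (leqW kn)) /extend kn.
by rewrite leq_eqVlt ltnS /extend => /predU1P[->|kn]; [rewrite ltnn|rewrite kn H].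
Qed.

Let P_extend n x u : P (path_event n.+1 (extend n x u)) =
  (P (path_event n x) * (srw_step G R (x n) u)%:E)%E.
Proof.
rewrite !srwX.2 -EFinM; congr EFin.
rewrite big_ord_recr/= mulrA /extend leqnn ltnn; congr (_ * _ * _).
by apply: eq_bigr => k _; rewrite ltnW// ltn_ord.
Qed.

Let P_neighbours n x : vertices G (x n) ->
  P (path_event n x `&` [set w | X n.+1 w \in neighbours (x n)]) =
  P (path_event n x).
Proof.
move=> Gx.
have -> : path_event n x `&` [set w | X n.+1 w \in neighbours (x n)] =
    \bigcup_(u in [set` neighbours (x n)]) path_event n.+1 (extend n x u).
  apply/seteqP; split => [w [pw Xw]|w [u uN]].
    by exists (X n.+1 w) => //; rewrite path_extend.
  by rewrite path_extend => -[pw /= ->].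
rewrite measure_fin_bigcup//; last first.
  by move=> u u' _ _ [w]; rewrite !path_extend => -[[_ /= <-] [_ /= <-]].
rewrite -fsbig_seq ?fset_uniq//=.
under eq_bigr do rewrite P_extend.
rewrite -ge0_sume_distrr; last by move=> u _; rewrite lee_fin divr_ge0.
rewrite sumEFin.
under eq_bigr do rewrite -[srw_step _ _ _ _]mulr1.
rewrite (sum_srw_step (fun=> 1))//.
rewrite (_ : \sum_(y <- _) 1 = deg (x n)); last first.
  by rewrite /deg card_fset_sum1 natr_sum.
by rewrite mulVf ?mule1// deg_neq0.
Qed.

(** Markov property, by one-step analysis: paths that leave the neighbours of the
    last vertex have probability zero, since the transition probabilities to the
    neighbours already add up to one. *)
Lemma no_visit_le n m x : vertices G (x n) ->
  (P (path_event n x `&` no_visit n m) <=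
   P (path_event n x) * (avoidance v m (x n))%:E)%E.
Proof.
elim: m n x => [|m IH] n x Gx.
  by rewrite /= mule1 le_measure ?inE//; exact: measurableI.
pose N := neighbours (x n).
pose A u := path_event n.+1 (extend n x u) `&` no_visit n.+1 m.
have mA u : measurable (A u) by exact: measurableI.
pose Z := path_event n x `\` (path_event n x `&` [set w | X n.+1 w \in N]).
have mN : measurable (path_event n x `&` [set w | X n.+1 w \in N]).
  by apply: measurableI => //; exact: srwX.1 n.+1 [set u | u \in N].
have Z0 : P Z = 0%E.
  rewrite measureD//; last by rewrite ltey_eq fin_num_measure.
  rewrite setIA setIid [X in (_ - X)%E](P_neighbours Gx).
  by rewrite subee// fin_num_measure.
have sub : path_event n x `&` no_visit n m.+1 `<=`
    Z `|` \bigcup_(u in [set` N]) (if u == v then set0 else A u).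
  move=> w [pw nw]; have [XN|XN] := boolP (X n.+1 w \in N); last first.
    by left; split => // -[_ /=]; apply/negP.
  right; exists (X n.+1 w) => //.
  have /negPf -> : X n.+1 w != v by apply: nw; rewrite ltnSn/= addnS ltnS leq_addr.
  split; first by rewrite path_extend.
  by move=> k /andP[k1 k2]; apply: nw; rewrite (ltnW k1) -addSnnS.
have mB : measurable (\bigcup_(u in [set` N]) (if u == v then set0 else A u)).
  by apply: fin_bigcup_measurable => // u _; case: ifP.
have mZ : measurable Z by exact: measurableD.
apply: le_trans (le_measure _ _ _ sub) _; rewrite ?inE.
- exact: measurableI.
- exact: measurableU.
apply: le_trans (measureU2 _ mZ mB) _; rewrite [X in (X + _)%E]Z0 add0e.
have AX u w : (if u == v then set0 else A u) w -> X n.+1 w = u.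
  by case: ifP => [_ []|_ [+ _]]; rewrite path_extend => -[].
rewrite measure_fin_bigcup//; last 2 first.
- by move=> u u' _ _ [w [/AX <- /AX]].
- by move=> u _; case: ifP.
rewrite -fsbig_seq ?fset_uniq//.
have -> : avoidance v m.+1 (x n) = \sum_(u <- N)
    srw_step G R (x n) u * ((u != v)%:R * avoidance v m u).
  by rewrite (sum_srw_step (fun u => (u != v)%:R * avoidance v m u)).
rewrite -sumEFin ge0_sume_distrr; last first.
  by move=> u _; rewrite lee_fin !mulr_ge0 ?avoidance_ge0// invr_ge0.
rewrite big_seq [leRHS]big_seq; apply: lee_sum => u uN.
case: eqVneq => [->|_].
  by rewrite measure0 mule_ge0// lee_fin !mulr_ge0 ?avoidance_ge0// invr_ge0.
rewrite mul1r EFinM muleA -P_extend.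
have := IH n.+1 (extend n x u); rewrite /extend ltnn; apply.
exact: vertices_neighbour uN.
Qed.

Lemma no_return_le n : vertices G v ->
  (P (no_visit 0 n) <= (avoidance v n v)%:E)%E.
Proof.
move=> Gv; pose x := fun _ : nat => v.
have P1 : P (path_event 0 x) = 1%E.
  by rewrite srwX.2 big_ord0 mulr1 asboolT.
have P0 : P (~` path_event 0 x) = 0%E by rewrite probability_setC// P1 subee.
have mE : measurable (path_event 0 x `&` no_visit 0 n) by exact: measurableI.
have mC : measurable (~` path_event 0 x) by exact: measurableC.
apply: (@le_trans _ _ (P (~` path_event 0 x `|` (path_event 0 x `&` no_visit 0 n)))).
  rewrite le_measure ?inE//; first exact: measurableU.
  by move=> w nw; have [?|?] := pselect (path_event 0 x w); [right|left].
apply: le_trans (measureU2 _ mC mE) _; rewrite [X in (X + _)%E]P0 add0e.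
by apply: le_trans (no_visit_le _ _) _; rewrite // P1 mul1e.
Qed.

Lemma ae_return : vertices G v -> escape v v = 0 ->
  {ae P, forall w, exists n, X n.+1 w = v}.
Proof.
move=> Gv e0.
have nvE : ~` [set w | exists n, X n.+1 w = v] = \bigcap_n no_visit 0 n.
  apply/seteqP; split => [w nw n _ [//|k] _|w nw [n Xn]].
    by apply/eqP => Xk; apply: nw; exists k.
  by have := nw n.+1 I n.+1; rewrite ltnSn Xn eqxx => /(_ isT).
have mN : measurable (\bigcap_n no_visit 0 n) by exact: bigcap_measurableType.
exists (\bigcap_n no_visit 0 n); split => //; last by rewrite -nvE.
have fin := fin_num_measure P _ mN.
have le n : fine (P (\bigcap_n no_visit 0 n)) <= avoidance v n v.
  rewrite -lee_fin fineK//; apply: le_trans (no_return_le n Gv).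
  by rewrite le_measure ?inE//; apply: bigcap_inf.
have : fine (P (\bigcap_n no_visit 0 n)) <= 0.
  rewrite -e0; apply: limr_ge; first exact: is_cvg_avoidance.
  by apply: nearW.
by rewrite -lee_fin fineK// measure_le0 => /eqP.
Qed.

End Walk.

Hypothesis exits : forall K : {fset V}, (forall u, u \in K -> vertices G u) ->
  exists (K' : {fset V}) d, (K `<=` K')%fset /\ one_exit K' d.

Section Energy.
Variable v : V.

Local Notation g := (potential v).
Local Notation "'dg' x" := (g (dart_to G x) - g (dart_from G x)) (at level 10).

Let C := deg v * escape v v.

(** Kirchhoff's law: the current created at [v] has to leave [K], and it can do so
    through one edge only, of unit conductance. *)
Lemma flux_exit (K : {fset V}) d : v \in K -> one_exit K d -> dg d = C.
Proof.
move=> vK Kd; have [KG _ _ _ _] := Kd.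
have := @sum_darts_from K d (fun x => dg x) Kd.
have -> : \sum_(x <- inner_darts K) dg x = 0.
  have : \sum_(x <- inner_darts K) dg x = - \sum_(x <- inner_darts K) dg x.
    rewrite {1}sum_inner_darts_rev// -sumrN; apply: eq_bigr => x _.
    by rewrite dart_from_rev dart_to_rev opprB.
  by move=> /eqP; rewrite -addr_eq0 -mulr2n mulrn_eq0/= => /eqP.
have dartsE u : u \in K ->
    \sum_(x <- darts u) dg x = (u == v)%:R * C.
  move=> /KG Gu; rewrite -(potential_laplacian v Gu) [LHS]big_seq [RHS]big_seq.
  by apply: eq_bigr => x; rewrite in_darts// => /asboolP[_ ->].
rewrite addr0 => <-; rewrite (big_fsetD1 v)//= dartsE// eqxx mul1r.
rewrite [X in _ + X](_ : _ = 0) ?addr0// big_seq big1// => u.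
by rewrite !inE => /andP[/negPf uv uK]; rewrite dartsE// uv mul0r.
Qed.

(** Summation by parts: the potential vanishes where its Laplacian does not, so the
    energy inside [K] is a boundary term. *)
Lemma energy_inner (K : {fset V}) d : v \in K -> one_exit K d ->
  \sum_(x <- inner_darts K) (dg x) ^+ 2 = 2 * (g (dart_from G d) * C).
Proof.
move=> vK Kd; have [KG _ _ _ _] := Kd.
have := @sum_darts_from K d (fun x => g (dart_from G x) * dg x) Kd.
set S := \sum_(x <- inner_darts K) _.
have -> : \sum_(u <- K) \sum_(x <- darts u) g (dart_from G x) * dg x = 0.
  rewrite big_seq big1// => u uK.
  transitivity (g u * \sum_(x <- darts u) (g (dart_to G x) - g u)).
    rewrite mulr_sumr [LHS]big_seq [RHS]big_seq; apply: eq_bigr => x.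
    by rewrite in_darts; [move=> /asboolP[_ ->]|exact: KG].
  rewrite potential_laplacian; last exact: KG.
  by rewrite {1}/potential; case: eqVneq; rewrite !mul0r ?mulr0.
rewrite (flux_exit vK Kd) => /esym/eqP; rewrite addr_eq0 => /eqP ->.
have : S + S = - \sum_(x <- inner_darts K) (dg x) ^+ 2.
  rewrite {1}/S sum_inner_darts_rev// /S -big_split/= -sumrN.
  apply: eq_bigr => x _; rewrite dart_from_rev dart_to_rev; ring.
by rewrite mulrN -mulr2n mulr_natl => ->; rewrite opprK.
Qed.

(** The exit edge of a set becomes an inner edge of a larger one-exit set, and
    carries the full current [C] there; each enlargement adds at least [C ^+ 2]. *)
Lemma energy_unbounded n : vertices G v -> exists (K : {fset V}) d,
  [/\ v \in K, one_exit K d &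
      n%:R * C ^+ 2 <= \sum_(x <- inner_darts K) (dg x) ^+ 2].
Proof.
move=> Gv; elim: n => [|n [K [d [vK Kd le]]]].
  have [K [d [vK Kd]]] :
      exists (K : {fset V}) d, ([fset v] `<=` K)%fset /\ one_exit K d.
    by apply: exits => u /[!inE] /eqP ->.
  exists K, d; split => //; first by rewrite (fsubsetP vK)// !inE.
  by rewrite mul0r sumr_ge0// => x _; rewrite sqr_ge0.
have [KG ed fd td dU] := Kd.
have [K' [d' [KK' Kd']]] :
    exists K' d', (dart_to G d |` K `<=` K')%fset /\ one_exit K' d'.
  apply: exits => u /[!inE] /orP[/eqP ->|/KG//]; exact: vertices_to.
exists K', d'; have sub : {subset K <= K'}.
  by move=> u uK; rewrite (fsubsetP KK')// !inE uK orbT.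
have [K'G _ _ _ _] := Kd'.
split => //; first exact: sub.
have dK' : d \in inner_darts K'.
  rewrite in_inner_darts//; apply/asboolP; split=> //; first exact: sub.
  by rewrite (fsubsetP KK')// !inE eqxx.
rewrite (big_fsetD1 d)//= (flux_exit vK Kd) -natr1 mulrDl mul1r addrC.
rewrite lerD2r; apply: le_trans le _.
rewrite (big_fsetID _ (mem (inner_darts K)) (inner_darts K' `\ d)%fset)/=.
set A := [fset x in _ | x \in _]%fset.
suff -> : A = inner_darts K.
  by rewrite lerDl sumr_ge0// => x _; rewrite sqr_ge0.
apply/fsetP => x; rewrite !inE/=.
apply/idP/idP => [/andP[]//|xK]; rewrite xK andbT.
move: xK; rewrite in_inner_darts// => /asboolP[ex fx tx].
rewrite in_inner_darts//; apply/andP; split.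
  by apply: contraNneq td => <-.
by apply/asboolP; split=> //; apply: sub.
Qed.

(** The energy is at most [2 * C] by [energy_inner] and at least [n%:R * C ^+ 2] for
    every [n], which leaves only a null current. *)
Lemma escape0 : vertices G v -> escape v v = 0.
Proof.
move=> Gv; have d0 : 0 < deg v by rewrite lt_def deg_neq0//= ler0n.
have C0 : 0 <= C by rewrite mulr_ge0 ?escape_ge0// ltW.
suff : C = 0 by move/eqP; rewrite mulf_eq0 gt_eqF//= => /eqP.
apply/eqP; apply: contrapT => /negP Cneq.
have Cgt : 0 < C by rewrite lt_def Cneq.
have [n nC] : exists n : nat, 2 / C < n%:R.
  by exists (Num.bound (2 / C)); apply: archi_boundP; rewrite divr_ge0.
have [K [d [vK Kd le]]] := energy_unbounded n Gv.
move: le; rewrite (energy_inner vK Kd) => le.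
have : n%:R * C ^+ 2 <= 2 * C.
  by apply: le_trans le _; rewrite ler_wpM2l// ler_piMl// potential_le1.
by rewrite expr2 mulrA ler_pM2r// -ler_pdivlMr// leNgt nC.
Qed.

End Energy.

(** Special case of the Nash-Williams criterion: infinitely many disjoint cutsets of
    size one have infinite total resistance. *)
Theorem one_exit_recurrent : srw_recurrent G R.
Proof.
split=> // v Gv d Omega P X srwX.
exact: ae_return srwX Gv (escape0 Gv).
Qed.

End OneEdgeCuts.

(** * Simple random walk with exponentially light killing *)

Section KilledWalk.
Variables (R : realType) (al be : nat -> R).

(** The probability that a simple symmetric walk started at height [h] reaches [0]
    within [j] steps and survives, when a step up, resp. down, from height [h] is
    survived with probability [al h], resp. [be h]. *)
Fixpoint hit (j h : nat) : R :=
  match h, j with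
  | 0, _ => 1
  | _.+1, 0 => 0
  | h'.+1, j'.+1 => 2^-1 * (al h * hit j' h.+1 + be h * hit j' h')
  end.

(** Once a concave sequence decreases, it does so at least linearly forever. *)
Lemma concave_bounded_below (u : nat -> R) (m : R) :
  (forall n, u n.+2 - u n.+1 <= u n.+1 - u n) -> (forall n, m <= u n) ->
  forall n, u n <= u n.+1.
Proof.
move=> conc um n; rewrite leNgt; apply/negP => lt.
pose s := u n - u n.+1; have s0 : 0 < s by rewrite subr_gt0.
have slope k : u (n + k).+1 - u (n + k)%N <= - s.
  by elim: k => [|k IH]; [rewrite addn0 opprB|rewrite addnS (le_trans (conc _))].
have low k : u (n + k)%N <= u n - k%:R * s.
  elim: k => [|k IH]; first by rewrite addn0 mul0r subr0.
  rewrite addnS -natr1; have := slope k; lra.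
have [k kb] : exists k : nat, (u n - m) / s < k%:R.
  exists (Num.bound ((u n - m) / s)); apply: archi_boundP.
  by rewrite divr_ge0 ?subr_ge0// ltW.
move: kb; rewrite ltr_pdivrMr// => kb.
by have := um (n + k)%N; have := low k; lra.
Qed.

Variables (C rho b0 : R).
Hypotheses (al0 : forall h, 0 <= al h) (al1 : forall h, al h <= 1).
Hypotheses (be0 : forall h, b0 <= be h) (be1 : forall h, be h <= 1).
Hypothesis b0_gt0 : 0 < b0.
Hypotheses (rho_gt0 : 0 < rho) (rho_lt1 : rho < 1) (C0 : 0 <= C).
Hypothesis al_tail : forall h, 1 - al h <= C * rho ^+ h.
Hypothesis be_tail : forall h, 1 - be h <= C * rho ^+ h.

Let be_ge0 h : 0 <= be h. Proof. exact: le_trans (ltW b0_gt0) (be0 h). Qed.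

Lemma hit_ge0 j h : 0 <= hit j h.
Proof.
elim: j h => [|j IH] [|h] //=.
by rewrite mulr_ge0// addr_ge0// mulr_ge0.
Qed.

Lemma hit_le1 j h : hit j h <= 1.
Proof.
elim: j h => [|j IH] [|h] //=.
have := @ler_pM _ _ _ _ _ (al0 h.+1) (hit_ge0 j h.+2) (al1 h.+1) (IH h.+2).
have := @ler_pM _ _ _ _ _ (be_ge0 h.+1) (hit_ge0 j h) (be1 h.+1) (IH h).
lra.
Qed.

Lemma hitS j h : hit j h <= hit j.+1 h.
Proof.
elim: j h => [|j IH] [|h] //.
  exact: hit_ge0.
by rewrite [leLHS]/= [leRHS]/= ler_wpM2l// lerD// ler_wpM2l.
Qed.

Lemma hit_homo h : {homo hit ^~ h : i j / (i <= j)%N >-> i <= j}.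
Proof. by apply/nondecreasing_seqP => j; exact: hitS. Qed.

Let f h := limn (hit ^~ h).

Let cvg_f h : hit j h @[j --> \oo] --> f h.
Proof.
apply: nondecreasing_is_cvgn; first exact: hit_homo.
by exists 1 => _ [j _ <-]; exact: hit_le1.
Qed.

Let f_ge0 h : 0 <= f h.
Proof.
apply: limr_ge; first exact: cvg_f.
by apply: nearW => j; exact: hit_ge0.
Qed.

Let f_le1 h : f h <= 1.
Proof.
apply: limr_le; first exact: cvg_f.
by apply: nearW => j; exact: hit_le1.
Qed.

Let f0 : f 0 = 1.
Proof.
apply: cvg_lim => //; rewrite (_ : hit ^~ 0%N = cst 1); first exact: cvg_cst.
by apply/funext => -[].
Qed.

Let fE h : f h.+1 = 2^-1 * (al h.+1 * f h.+2 + be h.+1 * f h).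
Proof.
have := @cvg_f h.+1; rewrite -cvg_shiftS => /cvg_lim <- //.
apply: cvg_lim => //=; apply: cvgMr; apply: cvgD; (apply: cvgMr; exact: cvg_f).
Qed.

(** Killing makes [f] convex, and a bounded convex sequence decreases. *)
Let f_noninc h : f h.+1 <= f h.
Proof.
rewrite -lerN2; move: h; apply: (@concave_bounded_below _ (-1)) => h.
  have := fE h; have := @ler_pM _ _ _ _ _ (al0 h.+1) (f_ge0 h.+2) (al1 h.+1) (lexx _).
  have := @ler_pM _ _ _ _ _ (be_ge0 h.+1) (f_ge0 h) (be1 h.+1) (lexx _).
  lra.
by rewrite lerN2.
Qed.

Let f_gt0 h : 0 < f h.
Proof.
elim: h => [|h IH]; first by rewrite f0.
rewrite fE mulr_gt0// ltr_wpDl ?mulr_ge0// mulr_gt0//.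
exact: lt_le_trans (be0 _).
Qed.

Let f_mono : {homo f : h k / (h <= k)%N >-> k <= h}.
Proof. exact/nonincreasing_seqP. Qed.

(** Beyond a large height [H], subtracting a multiple of [rho ^+ h] makes [f] concave,
    since the killing that bends it is itself of order [rho ^+ h].  Bounded concave
    sequences increase, so [f] never loses more than this multiple, which is at
    most half of [f H]. *)
Let f_lower : exists2 c : R, 0 < c & forall h, c <= f h.
Proof.
(* The second difference of [rho ^+ h] is [(1 - rho) ^+ 2 * rho ^+ h]; this [k]
   makes that of [k * rho ^+ h] equal to [2 * C * rho ^+ h.+1]. *)
pose k := 2 * C * rho / (1 - rho) ^+ 2.
have k0 : 0 <= k by rewrite divr_ge0 ?sqr_ge0// !mulr_ge0// ltW.
have [H kH] : exists H, k * rho ^+ H <= 2^-1.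
  have : k * rho ^+ n @[n --> \oo] --> k * 0.
    by apply: cvgMr; apply: cvg_expr; rewrite ger0_norm// ltW.
  rewrite mulr0 => /cvgrPdist_le/(_ 2^-1).
  case; [by rewrite invr_gt0|move=> N _ /(_ N (leqnn N))].
  rewrite sub0r normrN ger0_norm; first by exists N.
  by rewrite mulr_ge0// exprn_ge0// ltW.
have fH := f_gt0 H; exists (2^-1 * f H); first by rewrite mulr_gt0.
pose u n := f (H + n)%N - f H * k * rho ^+ (H + n).
have uS : forall n, u n <= u n.+1.
  apply: (@concave_bounded_below _ (- (f H * k))) => n; last first.
    have := f_ge0 (H + n).
    have : f H * k * rho ^+ (H + n) <= f H * k.
      rewrite ler_piMr//; first by rewrite mulr_ge0// ltW.
      by rewrite exprn_ile1// ltW.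
    rewrite /u; lra.
  rewrite /u !addnS; set m := (H + n)%N.
  have fm : f m <= f H by apply: f_mono; rewrite leq_addr.
  have f2 : f m.+2 <= f H by apply: le_trans fm; apply: f_mono; rewrite ltnW.
  have : f m.+2 + f m - 2 * f m.+1 <= 2 * C * rho ^+ m.+1 * f H.
    have E : f m.+2 + f m - 2 * f m.+1 =
        (1 - al m.+1) * f m.+2 + (1 - be m.+1) * f m by have := fE m; lra.
    rewrite E.
    have := @ler_pM _ _ _ _ _ _ (f_ge0 m.+2) (al_tail m.+1) f2.
    have := @ler_pM _ _ _ _ _ _ (f_ge0 m) (be_tail m.+1) fm.
    rewrite !subr_ge0 => /(_ (be1 _)) + /(_ (al1 _)); lra.
  have -> : 2 * C * rho ^+ m.+1 * f H =
      f H * k * (rho ^+ m.+2 + rho ^+ m - 2 * rho ^+ m.+1).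
    rewrite /k !exprS; field.
    by rewrite subr_eq0 gt_eqF.
  by lra.
have uH n : u 0 <= u n by elim: n => // n IH; exact: le_trans IH (uS n).
move=> h; have [hH|Hh] := leqP h H.
  by apply: le_trans (f_mono hH); lra.
have := uH (h - H)%N; rewrite /u addn0 subnKC ?(ltnW Hh)//.
have : 0 <= f H * k * rho ^+ h.
  by rewrite mulr_ge0 ?exprn_ge0 ?(ltW rho_gt0)// mulr_ge0// ltW.
have := ler_wpM2l (ltW fH) kH; lra.
Qed.

(** For bounded initial heights one time horizon is enough to get half of the
    limiting probability. *)
Lemma hit_lower : exists2 c : R, 0 < c &
  forall H, exists J, forall h, (h <= H)%N -> c <= hit J h.
Proof.
have [c c0 cf] := f_lower; exists (2^-1 * c); first by rewrite mulr_gt0.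
elim=> [|H [J HJ]].
  exists 0%N => h; rewrite leqn0 => /eqP ->.
  have := cf 0%N; rewrite f0/=; lra.
have [J' hJ'] : exists J', 2^-1 * c <= hit J' H.+1.
  have /cvgrPdist_le/(_ (2^-1 * c)) := @cvg_f H.+1.
  case; [by rewrite mulr_gt0|move=> N _ /(_ N (leqnn N))].
  by rewrite ler_distl => /andP[_ +]; have := cf H.+1; exists N; lra.
exists (maxn J J') => h; rewrite leq_eqVlt => /predU1P[->|hH].
  by apply: le_trans hJ' _; apply: hit_homo; rewrite leq_maxr.
by apply: le_trans (HJ h hH) _; apply: hit_homo; rewrite leq_maxl.
Qed.

End KilledWalk.

(** * Sizes of plane trees *)

Section PlaneTrees.

(** The induction scheme generated for [ptree] ignores the subtrees; this one pairs a
    property of trees with a property of forests. *)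
Lemma ptree_forest_ind (Q : ptree -> Prop) (S : seq ptree -> Prop) :
  S [::] -> (forall t s, Q t -> S s -> S (t :: s)) ->
  (forall s, S s -> Q (PNode s)) -> forall t, Q t.
Proof.
move=> S0 Scons QS; fix IH 1; case=> s; apply: QS.
by elim: s => [|t s IHs]; [exact: S0|exact: Scons].
Qed.

Fixpoint tree_edges (t : ptree) : nat :=
  let: PNode s := t in foldr (fun t' n => (tree_edges t').+1 + n)%N 0%N s.

Lemma tree_edges0 t : tree_edges t = 0%N -> t = PNode [::].
Proof. by case: t => -[]. Qed.

(** A named copy of the local fixpoint of [contour], so that induction can be done
    on the forest and on the index of its first tree. *)
Fixpoint forest_contour (c : nat) (s : seq ptree) : seq (seq nat) :=
  if s is t :: s' then
    map (cons c) (contour t) ++ [::] :: forest_contour c.+1 s'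
  else [::].

Lemma contourE s : contour (PNode s) = [::] :: forest_contour 0 s.
Proof. by []. Qed.

Lemma contour_root t : contour t = [::] :: behead (contour t).
Proof. by case: t. Qed.

Lemma contour_size t u : u \in contour t -> (size u <= tree_edges t)%N.
Proof.
move: t u; apply: (ptree_forest_ind (S := fun s => forall c u,
  u \in forest_contour c s -> (size u <= tree_edges (PNode s))%N)) => //.
  move=> t s IHt IHs c u; rewrite [forest_contour _ _]/= mem_cat inE.
  case/orP => [/mapP[v /IHt vt ->]|/predU1P[->//|/IHs us]] /=.
    by rewrite ltnS (leq_trans vt)// leq_addr.
  by rewrite (leq_trans us)// leq_addl.
by move=> s IHs u; rewrite contourE inE => /predU1P[->//|/IHs].
Qed.

Definition parent (u v : seq nat) : bool :=
  (size v == (size u).+1) && (take (size u) v == u).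

Definition adjacent (u v : seq nat) : bool := parent u v || parent v u.

Lemma contour_path t :
  path adjacent [::] (behead (contour t)) /\ last [::] (behead (contour t)) = [::].
Proof.
move: t; apply: (ptree_forest_ind (S := fun s => forall c,
  path adjacent [::] (forest_contour c s) /\
  last [::] (forest_contour c s) = [::])) => [//|t s [IHt lt] IHs c|s IHs].
  have [ps ls] := IHs c.+1.
  rewrite /= contour_root/= cat_path last_cat/= last_map lt ls ps andbT.
  split=> //.
  have -> : path adjacent [:: c] [seq c :: i | i <- behead (contour t)] =
      path adjacent [::] (behead (contour t)).
    rewrite path_map; apply: eq_path => u v.
    by rewrite /adjacent /parent /= !eqSS !eqseq_cons !eqxx.
  by rewrite IHt /adjacent /parent /= ?eqxx.
exact: IHs.
Qed.

(** The Dyck word of the contour exploration: two bits per edge, hence at most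
    [4 ^ n] trees with [n] edges. *)
Fixpoint tree_code (t : ptree) : seq bool :=
  let: PNode s := t in
  foldr (fun t' w => true :: tree_code t' ++ false :: w) [::] s.

Lemma size_tree_code t : size (tree_code t) = (tree_edges t).*2.
Proof.
move: t; apply: (ptree_forest_ind (S := fun s =>
  size (tree_code (PNode s)) = (tree_edges (PNode s)).*2)) => //= t s IHt IHs.
by rewrite size_cat/= IHs IHt addnS doubleD doubleS.
Qed.

(** Reads a code from right to left with a stack of forests: [false] closes a tree
    and opens the forest of its children, [true] turns the forest on top of the
    stack into a tree and puts it at the head of the next forest. *)
Let decode_step (b : bool) (st : seq (seq ptree)) : seq (seq ptree) :=
  if b then
    (PNode (head [::] st) :: head [::] (behead st)) :: behead (behead st)
  else [::] :: st.

Lemma tree_code_inj : injective tree_code.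
Proof.
have cancel t : forall st, foldr decode_step ([::] :: st) (tree_code t) =
    (let: PNode s := t in s) :: st.
  move: t; apply: (ptree_forest_ind (S := fun s => forall st,
    foldr decode_step ([::] :: st) (tree_code (PNode s)) = s :: st)) => //.
  by move=> [s'] s IHt IHs st; rewrite /= foldr_cat/= IHs (IHt (s :: st)).
move=> [s] [s'] e; congr PNode.
by have := cancel (PNode s) [::]; rewrite e cancel => -[].
Qed.

End PlaneTrees.

Section TreeTail.
Variables (R : realType) (p : R).
Hypotheses (p0 : 0 <= p) (p2 : p < 2^-1).

Lemma gw_weightE t : gw_weight (mu p) t = (1 - p) * (p * (1 - p)) ^+ tree_edges t.
Proof.
move: t; apply: (ptree_forest_ind (S := fun s =>
  foldr (fun t' w => gw_weight (mu p) t' * w) 1 s * p ^+ size s =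
  (p * (1 - p)) ^+ (tree_edges (PNode s)))) => [|t s IHt IHs|s IHs].
- by rewrite /= !expr0 mulr1.
- by rewrite /= exprD -IHs IHt !exprS; ring.
- by rewrite [LHS]/= /mu -IHs; ring.
Qed.

(** The midpoint of [4 * (p * (1 - p))] and [1], so as to be positive when [p] is [0].
    It is less than [1] because [p] is not [2^-1]; this is where subcriticality of
    the trees enters. *)
Definition tree_rate : R := 2^-1 * (1 + 4 * (p * (1 - p))).

Lemma tree_rate_gt0 : 0 < tree_rate.
Proof.
have : 0 <= p * (1 - p) by rewrite mulr_ge0// subr_ge0; move: p2; lra.
rewrite /tree_rate; lra.
Qed.

Lemma tree_rate_lt1 : tree_rate < 1.
Proof.
rewrite -subr_gt0 (_ : 1 - _ = 2 * (2^-1 - p) ^+ 2); last first.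
  by rewrite /tree_rate; field.
by rewrite mulr_gt0// exprn_gt0// subr_gt0.
Qed.

Let rate_ge : 4 * (p * (1 - p)) <= tree_rate.
Proof. have := tree_rate_lt1; rewrite /tree_rate; lra. Qed.

Variables (d : measure_display) (Omega : measurableType d).
Variables (P : probability Omega R) (X : Omega -> ptree).
Hypothesis rvX : discrete_rv X.
Hypothesis lawX : forall T, P [set w | X w = T] = (gw_weight (mu p) T)%:E.

(** The weight of a tree with [n] edges is at most [(p * (1 - p)) ^+ n], and there are
    at most [4 ^ n] such trees. *)
Lemma tree_edges_law_le n :
  (P [set w | tree_edges (X w) = n] <= (tree_rate ^+ n)%:E)%E.
Proof.
have q0 : 0 <= p * (1 - p) by rewrite mulr_ge0// subr_ge0; move: p2; lra.
have -> : [set w | tree_edges (X w) = n] =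
    \bigcup_(c in [set: n.*2.-tuple bool]) [set w | tree_code (X w) = c].
  apply/seteqP; split => [w <-|w [c _ /= e]].
    have sz : size (tree_code (X w)) == (tree_edges (X w)).*2.
      by rewrite size_tree_code.
    by exists (Tuple sz).
  by apply: double_inj; rewrite -size_tree_code e size_tuple.
rewrite measure_fin_bigcup//; last 3 first.
- exact: finite_finset.
- by move=> c c' _ _ [w [/= -> /val_inj]].
- by move=> c _; exact: rvX [set T | tree_code T = c].
apply: (@le_trans _ _
  (\sum_(c \in [set: n.*2.-tuple bool]) ((p * (1 - p)) ^+ n)%:E)%E).
  apply: lee_fsum => [|c _]; first exact: finite_finset.
  have [[T Tc]|nT] := pselect (exists T, tree_code T = c); last first.
    rewrite (_ : [set _ | _] = set0) ?measure0 ?lee_fin ?exprn_ge0//.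
    by apply/seteqP; split => // w /= Xc; apply: nT; exists (X w).
  rewrite (_ : [set _ | _] = [set w | X w = T]); last first.
    by apply/seteqP; split => w /=; rewrite -Tc; [apply: tree_code_inj|move->].
  apply: le_trans (_ : _ <= (gw_weight (mu p) T)%:E)%E _; first by rewrite -lawX.
  rewrite gw_weightE lee_fin.
  have -> : tree_edges T = n.
    by apply: double_inj; rewrite -size_tree_code Tc size_tuple.
  by rewrite ler_piMl ?exprn_ge0//; move: p0; lra.
have -> : [set: n.*2.-tuple bool] = [set` enum {: n.*2.-tuple bool}].
  by apply/seteqP; split => // c _; rewrite /= mem_enum.
rewrite -fsbig_seq ?enum_uniq//= big_enum/= sumEFin lee_fin sumr_const.
rewrite card_tuple card_bool -mulr_natl natrX -muln2 mulnC exprM -exprMn.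
rewrite (_ : 2 ^+ 2 = 4 :> R); last by rewrite -natrX.
by rewrite lerXn2r ?nnegrE ?(ltW tree_rate_gt0)// mulr_ge0.
Qed.

Lemma tree_edges_tail k :
  (P [set w | (k < tree_edges (X w))%N] <=
   (tree_rate / (1 - tree_rate) * tree_rate ^+ k)%:E)%E.
Proof.
have r0 := tree_rate_gt0; have r1 := tree_rate_lt1.
have mX (A : set nat) : measurable [set w | A (tree_edges (X w))].
  exact: rvX [set T | A (tree_edges T)].
have sub : [set w | (k < tree_edges (X w))%N] `<=`
    \bigcup_i [set w | tree_edges (X w) = (k.+1 + i)%N].
  by move=> w /= kw; exists (tree_edges (X w) - k.+1)%N => //=; rewrite subnKC.
apply: le_trans (measure_sigma_subadditive _ _ _ sub) _ => //.
- by move=> i; exact: mX [set e | e = (k.+1 + i)%N].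
- exact: mX [set e | (k < e)%N].
apply: lime_le; first by apply: is_cvg_nneseries => *; exact: measure_ge0.
apply: nearW => n.
apply: (@le_trans _ _ (\sum_(0 <= i < n) (tree_rate ^+ (k.+1 + i))%:E)%E).
  by apply: lee_sum => i _; exact: tree_edges_law_le.
rewrite sumEFin lee_fin.
have geo m : \sum_(0 <= i < m) tree_rate ^+ (k.+1 + i) =
    tree_rate ^+ k.+1 / (1 - tree_rate) * (1 - tree_rate ^+ m).
  elim: m => [|m IH]; first by rewrite big_geq// expr0 subrr mulr0.
  rewrite big_nat_recr//= IH exprD (exprS _ m); field.
  by rewrite subr_eq0 gt_eqF.
rewrite geo exprS (mulrAC tree_rate) ler_piMr//.
  by rewrite mulr_ge0 ?divr_ge0 ?exprn_ge0 ?subr_ge0// ltW.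
by rewrite gerBl exprn_ge0// ltW.
Qed.

(** A lower bound for the probability of having at most [k] edges.  The second bound
    may be negative for small [k]; the first one, the probability of a single
    vertex, keeps the maximum positive. *)
Definition small_prob (k : nat) : R :=
  Num.max (1 - p) (1 - tree_rate / (1 - tree_rate) * tree_rate ^+ k).

Lemma small_prob_le k :
  ((small_prob k)%:E <= P [set w | (tree_edges (X w) <= k)%N])%E.
Proof.
have mX (A : set nat) : measurable [set w | A (tree_edges (X w))].
  exact: rvX [set T | A (tree_edges T)].
have mk := mX [set e | (e <= k)%N].
rewrite /small_prob maxEge; case: ifP => _; last first.
  rewrite (_ : [set w | _] = ~` [set w | (k < tree_edges (X w))%N]); last first.
    apply/seteqP; split => w /= kw; [apply/negP|]; rewrite leqNgt ?negbK//.
    exact/negP.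
  rewrite probability_setC; last exact: mX [set e | (k < e)%N].
  by rewrite EFinB leeB// tree_edges_tail.
have := lawX (PNode [::]); rewrite gw_weightE/= expr0 mulr1 => <-.
apply: le_measure; rewrite ?inE//; first exact: rvX [set T | T = PNode [::]].
by move=> w /= ->.
Qed.

End TreeTail.

(** * Corners of the encoding *)

Section IntSums.
Variable f : int -> nat.

(** Sums over integer intervals, normalized to vanish at [0].  Both [graft_index] and
    the position of the first corner of a tree have this form, which reduces their
    inversion to [isum_locate]. *)
Definition isum (i : int) : int :=
  match i with
  | Posz n => Posz (\sum_(k < n) f (Posz k))%N
  | Negz n => - Posz (\sum_(k < n.+1) f (Negz k))%N
  end.

Lemma isumS (i : int) : isum (i + 1) = isum i + Posz (f i).
Proof.
case: i => [n|[|n]].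
- by rewrite -PoszD addn1 /isum big_ord_recr/= PoszD.
- by rewrite /= big_ord0 big_ord_recr big_ord0/= add0n addNr.
- have -> : Negz n.+1 + 1 = Negz n by lia.
  rewrite /isum [in RHS]big_ord_recr/= PoszD; lia.
Qed.

Lemma isum0 : isum 0 = 0.
Proof. by rewrite /= big_ord0. Qed.

Lemma isum_le (i j : int) : i <= j -> isum i <= isum j.
Proof.
move=> ij; have -> : j = i + Posz `|j - i|%N by lia.
elim: `|j - i|%N => [|n IH]; first by rewrite addr0.
have -> : i + Posz n.+1 = (i + Posz n) + 1 by lia.
by rewrite isumS; lia.
Qed.

Lemma isum_lt (i j : int) : i < j -> (0 < f i)%N -> isum i < isum j.
Proof.
by move=> ij fi; have := @isum_le (i + 1) j; rewrite isumS; lia.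
Qed.

Lemma isum_locate (j : int) :
  (exists i : int, isum i <= j) -> (exists i, j < isum i) ->
  exists i, isum i <= j < isum (i + 1).
Proof.
move=> [i0 le0] [i1 lt1].
have i01 : i0 < i1 by rewrite ltNge; apply/negP => /isum_le; lia.
have ex : exists n, j < isum (i0 + Posz n).
  by exists `|i1 - i0|%N; have -> : i0 + Posz `|i1 - i0| = i1 by lia.
case: (ex_minnP ex) => -[|n] jn min; first by move: jn; rewrite addr0; lia.
exists (i0 + Posz n).
have -> : i0 + Posz n + 1 = i0 + Posz n.+1 by lia.
by rewrite jn andbT leNgt; apply/negP => /min; rewrite ltnn.
Qed.

Lemma isum_unbounded : (forall i, (0 < f i)%N) ->
  forall j, (exists i : int, isum i <= j) /\ (exists i, j < isum i).
Proof.
move=> f0 j.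
have up n : Posz n <= isum (Posz n).
  elim: n => // n IH; have -> : Posz n.+1 = Posz n + 1 by lia.
  by rewrite isumS; have := f0 (Posz n); lia.
have dn n : isum (- Posz n) <= - Posz n.
  elim: n => [|n IH]; first by rewrite oppr0 isum0.
  have := isumS (- Posz n.+1).
  have -> : - Posz n.+1 + 1 = - Posz n by lia.
  have := f0 (- Posz n.+1); lia.
split; [exists (- Posz `|j|%N)|exists (Posz `|j|.+1)].
  by have := dn `|j|%N; lia.
by have := up `|j|.+1; lia.
Qed.

End IntSums.

Section Corners.
Variables (t : int -> ptree) (xi : int -> seq nat -> int) (b : int -> int).

Local Notation down := (down_step b).
Local Notation graft := (graft_index b).
Local Notation site := (graft_site b).
Local Notation crn := (corner t).
Local Notation L := (corner_label t xi b).

(** In a bridge, the trees grafted between [lo] and [hi] are so small that their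
    labels stay at least [l + 2], except for the root of the last one, which is a
    single vertex of label [l + 1]: at heights [1] and [2] above [l] the truncated
    predecessors leave room for no edge at all. *)
Definition is_bridge (l lo hi : int) : Prop :=
  [/\ b lo = l, b hi = l, forall i, lo < i -> i < hi -> l < b i &
      forall i, lo <= i -> i < hi -> down i ->
        (tree_edges (t (graft i)) <= `|b i - l|.-2)%N].

Hypothesis b0 : b 0 = 0.
Hypothesis b_step : forall i : int, b (i + 1) = b i + 1 \/ b (i + 1) = b i - 1.
Hypothesis xi_le1 : forall m u, `|xi m u| <= 1.
Hypothesis left_down : forall N : nat, exists2 i : int, i < - Posz N & down i.
Hypothesis bridges : forall N : nat, exists l lo hi : int,
  [/\ lo <= - Posz N, Posz N <= hi, l <= - Posz N & is_bridge l lo hi].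

Lemma graftS (i : int) : graft (i + 1) = graft i + Posz (down i).
Proof. exact: (isumS down i). Qed.

Lemma graft_le (i j : int) : i <= j -> graft i <= graft j.
Proof. exact: (@isum_le down). Qed.

Lemma graft_lt (i j : int) : i < j -> down i -> graft i < graft j.
Proof. by move=> ij di; apply: (@isum_lt down) => //; rewrite di. Qed.

(** To the right, every step down of [b] is a graft, so that [b] cannot become very
    negative without many grafts.  To the left [b] could decrease without any
    down-step, whence the hypothesis [left_down]. *)
Lemma graft_unbounded (j : int) : (exists i, graft i <= j) /\ (exists i, j < graft i).
Proof.
split.
  suff : forall n, exists i, graft i <= - Posz n.
    by move=> /(_ `|j|%N)[i gi]; exists i; lia.
  elim=> [|n [i gi]]; first by exists 0; rewrite /= big_ord0.
  have [k ki dk] := left_down `|i|%N; exists k.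
  by have := @graft_lt k i; lia.
have [l [lo [hi [_ hiN lN [_ bhi _ _]]]]] := bridges `|j|.+1.
exists hi; have -> : hi = Posz `|hi|%N by lia.
have pot n : 0 <= b (Posz n) + graft (Posz n).
  elim: n => [|n IH]; first by rewrite b0/= big_ord0.
  have -> : Posz n.+1 = Posz n + 1 by lia.
  rewrite graftS; have := b_step (Posz n); rewrite /down_step.
  by case => ->; lia.
have := pot `|hi|%N; have <- : hi = Posz `|hi|%N by lia.
lia.
Qed.

Lemma graft_inj (i j : int) : down i -> down j -> graft i = graft j -> i = j.
Proof.
move=> di dj gij; have [ij|ji|//] := ltgtP i j.
  by have := graft_lt ij di; lia.
by have := graft_lt ji dj; lia.
Qed.

Lemma siteP (m : int) : down (site m) /\ graft (site m) = m.
Proof.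
apply: (@xgetPex _ 0 [set i | down i /\ graft i = m]).
have [lo hi] := graft_unbounded m.
have [i] := @isum_locate down m lo hi; rewrite -[isum down]/graft graftS => gi.
exists i; case: (boolP (down i)) gi => /= di gi; last by lia.
by split => //; lia.
Qed.

Lemma site_graft i : down i -> site (graft i) = i.
Proof. by move=> di; have [ds gs] := siteP (graft i); exact: graft_inj. Qed.

Lemma site_lt (m i : int) : (site m < i) = (m < graft i).
Proof.
have [ds gs] := siteP m; apply/idP/idP => [/graft_lt/(_ ds)|mi]; first by lia.
by rewrite ltNge; apply/negP => /graft_le; lia.
Qed.

(** Between consecutive grafts the walk only goes up. *)
Lemma walk_up (i : int) n : (forall k : int, i <= k -> k < i + Posz n -> ~~ down k) ->
  b i <= b (i + Posz n).
Proof.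
elim: n => [|n IH] nd; first by rewrite addr0.
have -> : i + Posz n.+1 = i + Posz n + 1 by lia.
have : ~~ down (i + Posz n) by apply: nd; lia.
have := IH (fun k ik kn => nd k ik (ltac:(lia))).
by rewrite /down_step; case: (b_step (i + Posz n)) => ->; rewrite ?eqxx//; lia.
Qed.

Lemma site_le_walk (m i : int) : site m < i -> graft i = m + 1 -> b (site m) - 1 <= b i.
Proof.
move=> mi gi; have [ds gs] := siteP m.
have := @walk_up (site m + 1) `|i - (site m + 1)%R|%N.
have -> : site m + 1 + Posz `|i - (site m + 1)%R|%N = i by lia.
move: ds; rewrite /down_step => /eqP <-; apply => k mk ki; apply/negP => dk.
have := graft_lt ki dk.
have : site m < k by lia.
by rewrite site_lt; lia.
Qed.

Let len m := size (contour (t m)).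
Let off := isum len.

Let len_gt0 m : (0 < len m)%N.
Proof. by rewrite /len contour_root. Qed.

Let offS m : off (m + 1) = off m + Posz (len m). Proof. exact: isumS. Qed.

Let off_le m m' : m <= m' -> off m <= off m'. Proof. exact: isum_le. Qed.

Let size_flatten_contours (g : nat -> int)
    (h : int -> seq (int * seq nat)) n :
  (forall m, size (h m) = len m) ->
  size (flatten [seq h (g k) | k <- iota 0 n]) = (\sum_(k < n) len (g k))%N.
Proof.
move=> hlen; elim: n => [|n IH]; first by rewrite big_ord0.
have e : iota 0 n.+1 = iota 0 n ++ [:: n] by rewrite -addn1 iotaD.
by rewrite big_ord_recr -IH e map_cat flatten_cat size_cat/= cats0 hlen.
Qed.

(** Truncating the concatenation after [q.+1] contours is harmless since no contour is
    empty. *)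
Let nth_flatten_contours (g : nat -> int)
    (h : int -> seq (int * seq nat)) n k :
  (forall m, size (h m) = len m) -> (k < len (g n))%N ->
  let q := (\sum_(i < n) len (g i) + k)%N in
  nth (0, [::]) (flatten [seq h (g i) | i <- iota 0 q.+1]) q =
  nth (0, [::]) (h (g n)) k.
Proof.
move=> hlen kn q.
have nq : (n <= q)%N.
  rewrite /q; elim: n {kn q} => // n IH; rewrite big_ord_recr/=.
  by rewrite addnAC -addn1 leq_add.
have -> : iota 0 q.+1 = iota 0 n ++ n :: iota n.+1 (q - n).
  rewrite -[n :: _]/(iota n (q - n).+1) -subSn//.
  by rewrite -{1}(subnKC (leqW nq)) iotaD.
rewrite map_cat flatten_cat nth_cat size_flatten_contours//.
by rewrite ltnNge leq_addr/= addKn nth_cat hlen kn.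
Qed.

Lemma corner_at m k : (k < len m)%N ->
  crn (off m + Posz k) = (m, nth [::] (contour (t m)) k).
Proof.
have szt m' : size (tree_contour t m') = len m' by rewrite size_map.
have szr m' : size (rev (tree_contour t m')) = len m' by rewrite size_rev.
case: m => n kn.
  have -> : off (Posz n) + Posz k = Posz (\sum_(i < n) len (Posz i) + k)%N by [].
  by rewrite /corner (nth_flatten_contours szt)// (nth_map [::]).
pose k' := (len (Negz n) - k.+1)%N.
have -> : off (Negz n) + Posz k = Negz (\sum_(i < n) len (Negz i) + k')%N.
  by rewrite /off /isum big_ord_recr/=; move: kn; rewrite /k'; lia.
have k'n : (k' < len (Negz n))%N by rewrite /k'; lia.
rewrite /corner (nth_flatten_contours szr)// nth_rev szt//.
rewrite (nth_map [::])/=; last by move: k'n; rewrite /k' /len; lia.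
by congr (_, nth _ _ _); move: kn; rewrite /k' -/(len _); lia.
Qed.

Lemma corner_exists j : exists m k,
  [/\ (k < len m)%N, j = off m + Posz k & crn j = (m, nth [::] (contour (t m)) k)].
Proof.
have [lo hi] := isum_unbounded len_gt0 j.
have [m] := @isum_locate len j lo hi; rewrite -/off offS => mj.
exists m, `|j - off m|%N; have jE : j = off m + Posz `|j - off m| by lia.
have kl : (`|j - off m| < len m)%N by lia.
by split => //; rewrite {1}jE corner_at.
Qed.

Lemma corner_offset j m : (crn j).1 = m -> off m <= j < off (m + 1).
Proof.
by have [m' [k [kl -> ->]]] := corner_exists j => /= <-; rewrite offS; lia.
Qed.

Lemma corner_vertex j : ptree_vertices (t (crn j).1) (crn j).2.
Proof. by have [m [k [kl _ ->]]] := corner_exists j; exact: mem_nth. Qed.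

Lemma vertex_corner m u : ptree_vertices (t m) u -> exists j, crn j = (m, u).
Proof.
move=> ut; exists (off m + Posz (index u (contour (t m)))).
by rewrite corner_at ?index_mem// nth_index.
Qed.

Lemma corner_le (j j' : int) : j <= j' -> (crn j).1 <= (crn j').1.
Proof.
move=> jj'; rewrite leNgt; apply/negP => lt.
have := corner_offset (erefl (crn j).1); have := corner_offset (erefl (crn j').1).
have : off ((crn j').1 + 1) <= off (crn j).1 by apply: off_le; lia.
lia.
Qed.

Lemma tree_label_parent m u v : parent u v ->
  `|tree_label xi m v - tree_label xi m u| <= 1.
Proof.
move=> /andP[/eqP sv /eqP tv]; rewrite /tree_label sv big_ord_recr/=.
rewrite -sv take_size (eq_bigr (fun i : 'I_(size u) => xi m (take i.+1 u))).
  by rewrite addrAC subrr add0r.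
by move=> i _; rewrite -(take_takel v (ltn_ord i)) tv.
Qed.

Lemma tree_label_ge m u : - Posz (size u) <= tree_label xi m u.
Proof.
rewrite /tree_label; elim: (size u) => [|n IH]; first by rewrite big_ord0.
rewrite big_ord_recr/=; have := xi_le1 m (take n.+1 u).
rewrite ler_norml => /andP[x1 _].
have -> : - Posz n.+1 = - Posz n - 1 by lia.
exact: lerD.
Qed.

Lemma labelE m k : (k < len m)%N ->
  L (off m + Posz k) = tree_label xi m (nth [::] (contour (t m)) k) + b (site m).
Proof. by move=> kl; rewrite /corner_label corner_at. Qed.

Lemma label_first m : L (off m) = b (site m).
Proof.
have := @labelE m 0 (len_gt0 m); rewrite addr0 contour_root/= => ->.
by rewrite /tree_label big_ord0 add0r.
Qed.

Lemma label_last m : L (off (m + 1) - 1) = b (site m).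
Proof.
have := len_gt0 m; rewrite offS => l0.
have -> : off m + Posz (len m) - 1 = off m + Posz (len m).-1 by lia.
rewrite labelE ?prednK// /len nth_last contour_root/= (contour_path (t m)).2.
by rewrite /tree_label big_ord0 add0r.
Qed.

(** Inside a tree consecutive corners are adjacent; from a tree to the next one the
    walk makes one step down followed by steps up. *)
Lemma label_skip_free j : L j - 1 <= L (j + 1).
Proof.
have [m [k [kl -> _]]] := corner_exists j.
have [kS|kS] := ltnP k.+1 (len m); last first.
  have -> : off m + Posz k = off (m + 1) - 1 by rewrite offS; lia.
  rewrite label_last subrK label_first.
  have [ds gs] := siteP (m + 1); apply: site_le_walk => //.
  by rewrite site_lt gs; lia.
have -> : off m + Posz k + 1 = off m + Posz k.+1 by lia.
rewrite !labelE//; set c := contour (t m).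
suff : adjacent (nth [::] c k) (nth [::] c k.+1).
  by move=> /orP[] /(tree_label_parent m); lia.
have [/(pathP [::])/(_ k) + _] := contour_path (t m).
rewrite /c contour_root/=; apply.
by move: kS; rewrite /len contour_root.
Qed.

Lemma label_hit (j j' a : int) : j < j' -> a < L j -> L j' <= a ->
  exists i, [/\ j < i, i <= j', L i = a & forall k, j < k -> k < i -> a < L k].
Proof.
move=> jj' aj j'a.
have ex : exists n, L (j + Posz n) <= a.
  by exists `|j' - j|%N; have -> : j + Posz `|j' - j| = j' by lia.
case: (ex_minnP ex) => -[|n] jn min; first by move: jn; rewrite addr0; lia.
have low k : j <= k -> k < j + Posz n.+1 -> a < L k.
  move=> jk kn; rewrite ltNge; apply/negP => Lk.
  have := min `|k - j|%N; have -> : j + Posz `|k - j| = k by lia.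
  by move=> /(_ Lk); lia.
exists (j + Posz n.+1); split; [lia| | |].
- have := min `|j' - j|%N; have -> : j + Posz `|j' - j| = j' by lia.
  by move=> /(_ j'a); lia.
- have := label_skip_free (j + Posz n).
  have -> : j + Posz n + 1 = j + Posz n.+1 by lia.
  by have := low (j + Posz n); lia.
- by move=> k jk kn; apply: low => //; exact: ltW.
Qed.

(** * One-edge cuts from bridges *)

Section Bridge.
Variables (l lo hi : int).
Hypotheses (lohi : lo < hi) (br : is_bridge l lo hi).

Let inK j := (lo <= site (crn j).1) && (site (crn j).1 < hi).
Let m1 := graft (hi - 1).
Let jb := off m1.

Lemma bridge_end : [/\ lo < hi - 1, down (hi - 1) & b (hi - 1) = l + 1].
Proof.
have [blo bhi above _] := br.
have ne : lo <> hi - 1.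
  by move=> e; have := b_step lo; rewrite blo e subrK bhi; lia.
have lt : lo < hi - 1 by lia.
have := above (hi - 1) lt; have := b_step (hi - 1).
by rewrite subrK bhi /down_step subrK bhi => st al; split => //; lia.
Qed.

Let len1 : len m1 = 1%N.
Proof.
have [lt dh bh] := bridge_end; have [_ _ _ small] := br.
have := small (hi - 1) (ltW lt) (ltac:(lia)) dh; rewrite bh.
have -> : `|(l + 1)%R - l|.-2 = 0%N by lia.
by rewrite leqn0 => /eqP e; rewrite /len (tree_edges0 e).
Qed.

Let site1 : site m1 = hi - 1.
Proof. by apply: site_graft; have [] := bridge_end. Qed.

Let Tjb : (crn jb).1 = m1.
Proof. by have := @corner_at m1 0; rewrite addr0 => ->. Qed.

Let Ljb : L jb = l + 1.
Proof. by rewrite label_first site1; have [] := bridge_end. Qed.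

Lemma bridge_last_corner : inK jb.
Proof. by rewrite /inK Tjb site1; have [] := bridge_end; lia. Qed.

Let inK_le j : inK j -> j <= jb.
Proof.
move=> /andP[_]; rewrite site_lt => Tj; rewrite leNgt; apply/negP => lt.
have := corner_le (ltW lt); rewrite Tjb => m1j.
have [_ dh _] := bridge_end.
have e : (crn j).1 = m1.
  by have := graftS (hi - 1); rewrite subrK dh -/m1; lia.
by have := corner_offset e; rewrite offS len1 -/jb; lia.
Qed.

Lemma bridge_label j : inK j -> j != jb -> l + 2 <= L j.
Proof.
have [blo bhi above small] := br; have [lt dh bh] := bridge_end.
have [m [k [kl -> cj]]] := corner_exists j.
move=> /andP[]; rewrite cj/= => los shi njb.
have [ds gs] := siteP m.
have bS : b (site m + 1) = b (site m) - 1 by apply/eqP.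
have nlo : lo <> site m.
  by move=> e; have := above (lo + 1); rewrite e bS -e blo; lia.
have nhi : site m <> hi - 1.
  move=> e; move/eqP: njb; apply.
  have em : m = m1 by rewrite -gs e.
  by move: kl; rewrite em len1 ltnS leqn0 => /eqP ->; rewrite addr0.
have := above (site m + 1); rewrite bS => /(_ ltac:(lia) ltac:(lia)) bs.
have := small _ los shi ds; rewrite gs labelE// => sm.
have := tree_label_ge m (nth [::] (contour (t m)) k).
have := contour_size (mem_nth [::] kl).
have e : Posz `|b (site m) - l|.-2 = b (site m) - l - 2 by lia.
move: (size _) (tree_edges _) sm (tree_label _ _ _) => sz ed sm tl; lia.
Qed.

(** All corners of the bridge but the last have label at least [l + 2], while the last
    one has label [l + 1] and comes after them: by skip-freeness their successors
    do not jump over it. *)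
Lemma bridge_exit j k : is_successor t xi b j k -> inK j -> ~~ inK k -> j = jb.
Proof.
move=> [jk Lk min] jK; apply: contraNeq => njb.
have := bridge_label jK njb => Lj.
have jjb : j < jb by rewrite lt_neqAle njb inK_le.
have [|| i [ji ijb Li _]] := @label_hit j jb (L j - 1) jjb; [lia|lia|].
have kjb : k <= jb.
  rewrite leNgt; apply/negP => lt.
  by have := min i ji; rewrite Li eqxx => /(_ ltac:(lia)).
have := corner_le (ltW jk); have := corner_le kjb; rewrite Tjb.
move: jK; rewrite /inK !leNgt !site_lt => /andP[loj jhi] km1 jkT.
have [_ dh _] := bridge_end.
have := graftS (hi - 1); rewrite subrK dh -/m1; lia.
Qed.

Lemma bridge_jb_exit k : is_successor t xi b jb k -> ~~ inK k.
Proof. by move=> [jk _ _]; apply/negP => /inK_le; lia. Qed.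

(** The last corner before the bridge has label at most [l + 1], because the walk only
    goes up from its tree to [b lo = l].  A corner on the left whose successor has
    label at least [l + 1] therefore finds its successor before the bridge. *)
Lemma bridge_no_entry j k : is_successor t xi b j k -> inK k -> inK j.
Proof.
move=> [jk Lk min] kK; apply: contrapT => /negP jK.
have kjb := inK_le kK.
have Tjk := corner_le (ltW jk).
have Lk1 : l + 1 <= L k.
  have [->|/(bridge_label kK)] := eqVneq k jb; [by rewrite Ljb|lia].
have jlo : site (crn j).1 < lo.
  move: kK jK; rewrite /inK !leNgt !site_lt; lia.
have gk : graft lo <= (crn k).1.
  by move: kK => /andP[+ _]; rewrite leNgt site_lt; lia.
pose m2 := graft lo - 1.
have s2 : site m2 < lo by rewrite site_lt /m2; lia.
have g2 : graft lo = m2 + 1 by rewrite subrK.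
have b2 := site_le_walk s2 g2.
have L2 := label_last m2.
have je : j <= off (m2 + 1) - 1.
  have := corner_offset (erefl (crn j).1).
  have : off ((crn j).1 + 1) <= off (m2 + 1).
    by apply: off_le; move: jlo; rewrite site_lt /m2; lia.
  lia.
have ke : off (m2 + 1) - 1 < k.
  have := corner_offset (erefl (crn k).1).
  have : off (m2 + 1) <= off (crn k).1 by apply: off_le; rewrite /m2; lia.
  lia.
have [blo _ _ _] := br.
have [e|nej] := eqVneq j (off (m2 + 1) - 1).
  by move: Lk1 b2; rewrite Lk e L2; lia.
have jlt : j < off (m2 + 1) - 1 by rewrite lt_neqAle nej.
have [|| i [ji ile Li _]] := @label_hit j _ (L j - 1) jlt; [lia|by rewrite L2; lia|].
by have := min i ji; rewrite Li eqxx => /(_ ltac:(lia)).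
Qed.

Definition bridge_vertices : {fset int * seq nat} :=
  [fset v in flatten [seq tree_contour t (graft lo + Posz k) |
                      k <- iota 0 `|graft hi - graft lo|]]%fset.

Lemma in_bridge_vertices m u : ((m, u) \in bridge_vertices) =
  [&& lo <= site m, site m < hi & u \in contour (t m)].
Proof.
have glh := graft_le (ltW lohi).
rewrite !inE; apply/flattenP/and3P => [[_ /mapP[k + ->] /mapP[u' u't [-> ->]]]|].
  rewrite mem_iota => kn; split => //; rewrite ?leNgt site_lt; lia.
rewrite leNgt !site_lt => -[m0 mhi ut].
exists (tree_contour t m); last exact: map_f.
apply/mapP; exists `|m - graft lo|%N; first by rewrite mem_iota; lia.
by congr tree_contour; lia.
Qed.

Lemma corner_in_bridge j : (crn j \in bridge_vertices) = inK j.
Proof.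
by rewrite [crn j]surjective_pairing in_bridge_vertices corner_vertex andbT.
Qed.

Lemma finite_bridge_corners :
  finite_set [set x : int * bool | crn x.1 \in bridge_vertices].
Proof.
apply: (@sub_finite_set _ _ ((fun kc => (off (graft lo) + Posz kc.1, kc.2)) @`
    (`I_`|off (graft hi) - off (graft lo)| `*` [set: bool]))).
  move=> [j c] /=; rewrite corner_in_bridge /inK leNgt !site_lt => jK.
  have := corner_offset (erefl (crn j).1).
  have : off (graft lo) <= off (crn j).1 by apply: off_le; lia.
  have : off ((crn j).1 + 1) <= off (graft hi) by apply: off_le; lia.
  move=> o1 o2 o3; exists (`|j - off (graft lo)|%N, c) => /=.
    by split => //; lia.
  by congr (_, _); lia.
by apply: finite_image; apply: finite_setX => //; exact: finite_finset.
Qed.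

End Bridge.

Local Notation G := (uihpq t xi b).

Lemma bridge_around (N : nat) : exists l lo hi : int,
  [/\ lo < hi, is_bridge l lo hi, lo <= - Posz N & Posz N < hi - 1].
Proof.
have [l [lo [hi [loN hiN _ br]]]] := bridges N.+2.
by exists l, lo, hi; split => //; lia.
Qed.

(** In a large bridge the last corner has a smaller label than any given corner, so
    the successor exists by skip-freeness. *)
Lemma successorP j : is_successor t xi b j (successor t xi b j).
Proof.
apply: (@xgetPex _ j (is_successor t xi b j)).
have [l [lo [hi [lohi br loN hiN]]]] := bridge_around `|site (crn j).1|%N.
have [_ dh bh] := bridge_end lohi br.
pose m1 := graft (hi - 1).
have s1 : site m1 = hi - 1 by apply: site_graft.
have jjb : j < off m1.
  have := corner_offset (erefl (crn j).1).
  have : off ((crn j).1 + 1) <= off m1.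
    apply: off_le; have : site (crn j).1 < hi - 1 by lia.
    by rewrite site_lt -/m1; lia.
  lia.
have Lj : l + 2 <= L j.
  have := @bridge_label l lo hi lohi br j; apply; last by rewrite lt_eqF.
  by apply/andP; split; lia.
have [|| i [ji _ Li low]] := @label_hit j _ (L j - 1) jjb.
- by lia.
- by rewrite label_first s1 bh; lia.
by exists i; split => // k jk ki; rewrite gt_eqF// low.
Qed.

Lemma uihpq_edges j : edges G j.
Proof. by exists (successor t xi b j); exact: successorP. Qed.

Lemma uihpq_edge_ends e : edges G e ->
  vertices G (Defs.tail G e) /\ vertices G (Defs.head G e).
Proof. by move=> _; split; exact: corner_vertex. Qed.

Lemma bridge_containing (K : {fset int * seq nat}) :
  (forall v, v \in K -> vertices G v) ->
  exists l lo hi : int, [/\ lo < hi, is_bridge l lo hi &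
    {subset K <= bridge_vertices lo hi}].
Proof.
move=> KG; pose N := (\sum_(v <- K) `|site v.1|)%N.
have [l [lo [hi [lohi br loN hiN]]]] := bridge_around N.
exists l, lo, hi; split => // -[m u] muK.
have le : (`|site m| <= N)%N.
  by rewrite /N (big_fsetD1 (m, u) muK)/= leq_addr.
rewrite (in_bridge_vertices lohi br); apply/and3P; split; [lia|lia|].
exact: KG (m, u) muK.
Qed.

(** No edge enters a bridge from outside, so that all edges at its vertices start from
    one of its finitely many corners. *)
Lemma uihpq_well_defined : srw_well_defined G.
Proof.
move=> [m u] Gmu; split; last first.
  have [j cj] := vertex_corner Gmu; exists (j, true).
  by split => //; exact: uihpq_edges.
have [|l [lo [hi [lohi br sub]]]] := @bridge_containing [fset (m, u)]%fset.
  by move=> v /[!inE] /eqP ->.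
have mK : (m, u) \in bridge_vertices lo hi by apply: sub; rewrite inE.
apply: sub_finite_set (finite_bridge_corners lohi br).
move=> [e c] [_ /= emu]; move: mK; rewrite -emu; case: c {emu} => //.
rewrite /dart_from/= !(corner_in_bridge lohi br).
exact: bridge_no_entry lohi br _ _ (successorP e).
Qed.

(** The exit is the arc from the single vertex of the last tree of the bridge. *)
Lemma uihpq_exits (K : {fset int * seq nat}) :
  (forall v, v \in K -> vertices G v) ->
  exists (K' : {fset int * seq nat}) d, (K `<=` K')%fset /\ one_exit G K' d.
Proof.
move=> /bridge_containing[l [lo [hi [lohi br sub]]]].
exists (bridge_vertices lo hi), (off (graft (hi - 1)), true).
split; first exact/fsubsetP.
split.
- by move=> [m u]; rewrite (in_bridge_vertices lohi br) => /and3P[].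
- exact: uihpq_edges.
- by rewrite /dart_from/= (corner_in_bridge lohi br); exact: bridge_last_corner lohi br.
- rewrite /dart_to/= (corner_in_bridge lohi br).
  exact: bridge_jb_exit lohi br _ (successorP _).
- move=> [e c] _; case: c; rewrite /dart_from /dart_to/= !(corner_in_bridge lohi br).
    by move=> eK sK; rewrite (bridge_exit lohi br (successorP e) eK sK).
  move=> sK /negP[]; exact: bridge_no_entry lohi br _ _ (successorP e) sK.
Qed.

Theorem uihpq_recurrent (R : realType) : srw_recurrent G R.
Proof.
exact: one_exit_recurrent uihpq_well_defined uihpq_edge_ends uihpq_exits.
Qed.

End Corners.

(** * Discrete random variables *)

Section DiscreteVariables.
Variables (R : realType) (d : measure_display) (Omega : measurableType d).
Variable P : probability Omega R.

Definition pr (E : set Omega) : R := fine (P E).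

Lemma prE E : measurable E -> P E = (pr E)%:E.
Proof. by move=> mE; rewrite /pr fineK ?fin_num_measure. Qed.

Lemma pr_ge0 E : 0 <= pr E.
Proof. by rewrite fine_ge0. Qed.

Lemma pr_le E F : measurable E -> measurable F -> E `<=` F -> pr E <= pr F.
Proof.
by move=> mE mF EF; rewrite -lee_fin -!prE// le_measure ?inE.
Qed.

Lemma prU E F : measurable E -> measurable F -> E `&` F = set0 ->
  pr (E `|` F) = pr E + pr F.
Proof.
move=> mE mF EF; apply: EFin_inj; rewrite EFinD -!prE//; last exact: measurableU.
by rewrite measureU.
Qed.

Lemma pr_leU E F : measurable E -> measurable F -> pr (E `|` F) <= pr E + pr F.
Proof.
move=> mE mF; rewrite -lee_fin EFinD -!prE//; last exact: measurableU.
exact: measureU2.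
Qed.

Lemma pr_setT : pr setT = 1.
Proof. by rewrite /pr probability_setT. Qed.

Lemma pr_set0 : pr set0 = 0.
Proof. by rewrite /pr measure0. Qed.

Lemma prC E : measurable E -> pr (~` E) = 1 - pr E.
Proof.
move=> mE; apply: EFin_inj; rewrite -prE; last exact: measurableC.
by rewrite probability_setC// prE.
Qed.

Lemma pr_negligible (A : set Omega) :
  (forall e : R, 0 < e -> exists D, [/\ measurable D, A `<=` D & pr D <= e]) ->
  P.-negligible A.
Proof.
move=> H.
have /choice[D HD] : forall n : nat, exists D,
    [/\ measurable D, A `<=` D & pr D <= n.+1%:R^-1].
  move=> n; have n0 : 0 < n.+1%:R^-1 :> R by rewrite invr_gt0.
  by have [D HD] := H _ n0; exists D.
have mD : measurable (\bigcap_n D n).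
  by apply: bigcap_measurableType => n _; have [] := HD n.
exists (\bigcap_n D n); split => //; last first.
  by move=> w Aw n _; have [_ AD _] := HD n; exact: AD.
rewrite prE//; congr EFin; apply/eqP; rewrite eq_le pr_ge0 andbT.
apply/ler_addgt0Pl => e e0; rewrite addr0.
have [n ne] : exists n : nat, n.+1%:R^-1 <= e.
  exists (Num.bound e^-1); rewrite invf_ple ?posrE//.
  apply: ltW; apply: lt_trans (archi_boundP _) _; first by rewrite invr_ge0 ltW.
  by rewrite ltr_nat.
apply: le_trans ne; have [mDn _ Dn] := HD n; apply: le_trans Dn.
by apply: pr_le => // w; apply.
Qed.

Lemma ae_forall_countable (T : countType) (Q : T -> Omega -> Prop) :
  (forall x, {ae P, forall w, Q x w}) -> {ae P, forall w, forall x, Q x w}.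
Proof.
move=> aeQ.
pose F n := if @choice.unpickle T n is Some x then ~` [set w | Q x w] else set0.
have : P.-negligible (\bigcup_n F n).
  apply: negligible_bigcup => n; rewrite /F.
  case: (@choice.unpickle T n) => [x|]; first exact: aeQ.
  exact: negligible_set0.
apply: negligibleS => w /= /existsNP[x nQ]; exists (choice.pickle x) => //.
by rewrite /F choice.pickleK.
Qed.

Section Discrete.
Variables (T : countType) (X : Omega -> T).
Hypothesis dX : discrete_rv X.

(** Needed for [Y] the size of a tree and [X] its random index. *)
Lemma discrete_bind (U : Type) (Y : T -> Omega -> U) :
  (forall x, discrete_rv (Y x)) -> discrete_rv (fun w => Y (X w) w).
Proof.
move=> dY B.
pose F n := if @choice.unpickle T n is Some x
  then X @^-1` [set x] `&` Y x @^-1` B else set0.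
have -> : (fun w => Y (X w) w) @^-1` B = \bigcup_n F n.
  apply/seteqP; split => w /=.
    by move=> YB; exists (choice.pickle (X w)) => //; rewrite /F choice.pickleK.
  by move=> [n _]; rewrite /F; case: (@choice.unpickle T n) => // x [/= -> ].
apply: bigcupT_measurable => n; rewrite /F; case: (@choice.unpickle T n) => // x.
by apply: measurableI; [exact: dX|exact: dY].
Qed.

Lemma discrete_comp (U : Type) (f : T -> U) : discrete_rv (f \o X).
Proof. by move=> B; exact: dX (f @^-1` B). Qed.

Lemma discrete_pair (U : Type) (Y : Omega -> U) :
  discrete_rv Y -> discrete_rv (fun w => (X w, Y w)).
Proof.
move=> dY; apply: (discrete_bind (Y := fun x w => (x, Y w))) => x B.
exact: dY (pair x @^-1` B).
Qed.

(** Conditioning on a countably-valued variable: an inequality that holds on each of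
    its level sets can be summed. *)
Lemma pr_le_by_value (E F : set Omega) (a : R) : 0 <= a ->
  measurable E -> measurable F ->
  (forall x, pr (E `&` [set w | X w = x]) <= a * pr (F `&` [set w | X w = x])) ->
  pr E <= a * pr F.
Proof.
move=> a0 mE mF le.
pose A n := [set w | choice.pickle (X w) = n].
have mA n : measurable (A n) by exact: dX [set x | choice.pickle x = n].
have split G : measurable G -> P G = (\sum_(0 <= n <oo) P (G `&` A n))%E.
  move=> mG; rewrite -measure_semi_bigcup//.
  - rewrite -setI_bigcupr (_ : \bigcup_n A n = setT) ?setIT//.
    by apply/seteqP; split => // w _; exists (choice.pickle (X w)).
  - by move=> n; exact: measurableI.
  - by move=> i j _ _ [w [[_ <-] [_ <-]]].
  - by apply: bigcupT_measurable => n; exact: measurableI.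
rewrite -lee_fin EFinM -!prE// (split _ mE) (split _ mF).
rewrite -nneseriesZl//.
apply: lee_nneseries => [n _ _|n _]; first exact: measure_ge0.
rewrite !prE -?EFinM ?lee_fin; [|exact: measurableI|exact: measurableI].
case E1 : (@pickle_inv T n) => [x|]; last first.
  have -> : A n = set0.
    apply/seteqP; split => // w /= e.
    by have := pickleK_inv (X w); rewrite e E1.
  by rewrite !setI0 pr_set0 mulr0.
have -> : A n = [set w | X w = x]; last exact: le.
apply/seteqP; split => w /=.
  by move=> e; have := pickleK_inv (X w); rewrite e E1 => -[].
by move=> Xw; rewrite /A/= Xw; have := @pickle_invK T n; rewrite E1.
Qed.

End Discrete.

End DiscreteVariables.

(** * Exploring the encoding from the origin *)

Section Encoding.
Variables (R : realType) (p : R) (d : measure_display).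
Variables (Omega : measurableType d) (P : probability Omega R).
Variables (t : int -> Omega -> ptree) (xi : int -> seq nat -> Omega -> int).
Variable b : int -> Omega -> int.
Hypotheses (p0 : 0 <= p) (p2 : p < 2^-1).
Hypothesis enc : uihpq_encoding p P t xi b.

Local Notation key := (int + int * seq nat + int)%type.
Local Notation F := (encoding_events t xi b).
Local Notation Pr := (pr P).
Local Notation graft i w := (graft_index (b ^~ w) i).
Local Notation down i w := (down_step (b ^~ w) i).

Let step (i : int) (w : Omega) : int := b (i + 1) w - b i w.

Lemma discrete_step i : discrete_rv (step i).
Proof.
have := discrete_pair (walk_rv enc i) (walk_rv enc (i + 1)).
by move=> /(discrete_comp)/(_ _ (fun xy : int * int => xy.2 - xy.1)).
Qed.

Lemma encoding_events_measurable k A : F k A -> measurable A.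
Proof.
case: k => [[i|[i u]]|i] [B _ <-].
- exact: tree_rv enc i B.
- exact: disp_rv enc i u B.
- exact: discrete_step.
Qed.

(** The sources of randomness consulted when the steps of [b] over the interval from
    [lo] to [hi] and the trees of index from [dl] to [dr] have been explored. *)
Definition window (lo hi dl dr : int) (k : key) : bool :=
  match k with
  | inl (inl m) => (dl <= m) && (m < dr)
  | inl (inr _) => false
  | inr i => (lo <= i) && (i < hi)
  end.

Definition cylinder (lo hi dl dr : int) (E : set Omega) : Prop :=
  exists (J : {fset key}) (A : key -> set Omega),
    [/\ forall k, k \in J -> window lo hi dl dr k,
        forall k, k \in J -> F k (A k) &
        E = \bigcap_(k in [set` J]) A k].

Lemma cylinder_measurable lo hi dl dr E : cylinder lo hi dl dr E -> measurable E.
Proof.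
move=> [J [A [_ FA ->]]]; apply: fin_bigcap_measurable => // k kJ.
exact: encoding_events_measurable (FA k kJ).
Qed.

Lemma cylinder_setT lo hi dl dr : cylinder lo hi dl dr setT.
Proof.
exists fset0, (fun=> setT); split => //.
by apply/seteqP; split => // w _ k /=; rewrite inE.
Qed.

Lemma pr_cylinder (J : {fset key}) (A : key -> set Omega) :
  (forall k, k \in J -> F k (A k)) ->
  Pr (\bigcap_(k in [set` J]) A k) = \prod_(k <- J) Pr (A k).
Proof.
move=> FA; have mA k : k \in J -> measurable (A k).
  by move=> /FA; exact: encoding_events_measurable.
apply: EFin_inj; rewrite -prE ?(encoding_indep enc FA); last first.
  exact: fin_bigcap_measurable.
rewrite big_seq [in RHS]big_seq.
apply: (big_ind2 (fun (x : \bar R) (y : R) => x = y%:E)) => //.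
  by move=> x x' y y' -> ->; rewrite EFinM.
by move=> k /mA; exact: prE.
Qed.

(** A fresh source is independent of the explored ones. *)
Lemma cylinder_cap (lo hi dl dr lo' hi' dl' dr' : int) E k B :
  lo' <= lo -> hi <= hi' -> dl' <= dl -> dr <= dr' ->
  cylinder lo hi dl dr E -> F k B ->
  ~~ window lo hi dl dr k -> window lo' hi' dl' dr' k ->
  cylinder lo' hi' dl' dr' (E `&` B) /\ Pr (E `&` B) = Pr E * Pr B.
Proof.
move=> llo lhi ldl ldr [J [A [wJ FA EA]]] FB nk wk.
have kJ : k \notin J by apply: contra nk => /wJ.
pose A' k' := if k' == k then B else A k'.
have FA' k' : k' \in (k |` J)%fset -> F k' (A' k').
  by rewrite /A' !inE; case: eqP => [->//|_ /= /FA].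
have EB : E `&` B = \bigcap_(k' in [set` (k |` J)%fset]) A' k'.
  rewrite EA /A'; apply/seteqP; split => w.
    move=> [Aw Bw] k' /=; rewrite !inE; case: eqP => //= _ k'J; exact: Aw.
  move=> Aw; split; last by have := Aw k; rewrite /= !inE eqxx; apply.
  move=> k' k'J; have := Aw k'; rewrite /= !inE.
  case: eqP => [e|_ /(_ k'J)//]; by move: kJ; rewrite -e k'J.
split.
  exists (k |` J)%fset, A'; split => // k'; rewrite !inE => /predU1P[->//|/wJ].
  case: k' => [[m|[]]|i] //= /andP[? ?]; lia.
rewrite EB pr_cylinder// big_fsetU1//= {1}/A' eqxx mulrC EA pr_cylinder//.
congr (_ * _); apply: eq_big_seq => k' k'J; rewrite /A'; case: eqP => // e.
by move: kJ; rewrite -e k'J.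
Qed.

(** On such a cylinder the walk and the number of grafts at both ends are constant, so
    that the index of the next tree on either side is known and its tree is fresh,
    although tree indices are random in general. *)
Definition walk_state (lo hi bl br dl dr : int) (E : set Omega) : Prop :=
  [/\ lo <= hi, dl <= dr, cylinder lo hi dl dr E &
      forall w, E w -> [/\ b lo w = bl, b hi w = br,
        graft lo w = dl & graft hi w = dr]].

Lemma pr_step i x : x \in [:: -1; 1] -> Pr [set w | step i w = x] = 2^-1.
Proof. by move=> x1; rewrite /pr (walk_law enc i x1). Qed.

Let step_event i x : F (inr i) [set w | step i w = x].
Proof. by exists [set x]. Qed.

Let size_event m (B : set nat) :
  F (inl (inl m)) [set w | B (tree_edges (t m w))].
Proof. by exists [set T | B (tree_edges T)]. Qed.

Lemma graftS_w (i : int) w : graft (i + 1) w = graft i w + Posz (down i w).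
Proof. exact: graftS. Qed.

Let down_stepE (i : int) w : down i w = (step i w == -1).
Proof. by rewrite /down_step /step subr_eq (addrC (-1)). Qed.

Lemma state_right_up lo hi bl br dl dr E : walk_state lo hi bl br dl dr E ->
  let E' := E `&` [set w | step hi w = 1] in
  walk_state lo (hi + 1) bl (br + 1) dl dr E' /\ Pr E' = 2^-1 * Pr E.
Proof.
move=> [lh dd cE sE] E'.
have [| | | |||cE' ->] := @cylinder_cap lo hi dl dr lo (hi + 1) dl dr E (inr hi)
  [set w | step hi w = 1] _ _ _ _ cE (step_event hi 1); rewrite /=; try lia.
split; last by rewrite pr_step// mulrC.
split => //; first by lia.
move=> w [/sE[bl_ br_ dl_ dr_] st]; split => //.
  by move: st; rewrite /= /step; lia.
by rewrite graftS_w dr_ down_stepE st addr0.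
Qed.

Lemma state_right_down lo hi bl br dl dr E (B : set nat) :
  walk_state lo hi bl br dl dr E ->
  let E' := E `&` [set w | step hi w = -1] `&`
              [set w | B (tree_edges (t dr w))] in
  walk_state lo (hi + 1) bl (br - 1) dl (dr + 1) E' /\
  Pr E' = 2^-1 * Pr [set w | B (tree_edges (t dr w))] * Pr E.
Proof.
move=> [lh dd cE sE] E'.
have [| | | |||cE1 p1] := @cylinder_cap lo hi dl dr lo (hi + 1) dl dr E (inr hi)
  [set w | step hi w = -1] _ _ _ _ cE (step_event hi (-1)); rewrite /=; try lia.
have [| | | |||cE2 p2'] := @cylinder_cap lo (hi + 1) dl dr lo (hi + 1) dl (dr + 1)
  _ (inl (inl dr)) _ _ _ _ _ cE1 (size_event dr B); rewrite /=; try lia.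
split; last by rewrite p2' p1 pr_step//; ring.
split => //; [lia|lia|].
move=> w [[/sE[bl_ br_ dl_ dr_] st] _]; split => //.
  by move: st; rewrite /= /step; lia.
by rewrite graftS_w dr_ down_stepE st eqxx.
Qed.

Lemma state_left_up lo hi bl br dl dr E : walk_state lo hi bl br dl dr E ->
  let E' := E `&` [set w | step (lo - 1) w = 1] in
  walk_state (lo - 1) hi (bl - 1) br dl dr E' /\ Pr E' = 2^-1 * Pr E.
Proof.
move=> [lh dd cE sE] E'.
have [| | | |||cE' ->] := @cylinder_cap lo hi dl dr (lo - 1) hi dl dr E
  (inr (lo - 1)) [set w | step (lo - 1) w = 1] _ _ _ _ cE (step_event _ 1);
  rewrite /=; try lia.
split; last by rewrite pr_step// mulrC.
split => //; first by lia.
move=> w [/sE[bl_ br_ dl_ dr_] st]; split => //.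
  by move: st; rewrite /= /step subrK; lia.
by have := graftS_w (lo - 1) w; rewrite subrK dl_ down_stepE st addr0.
Qed.

Lemma state_left_down lo hi bl br dl dr E (B : set nat) :
  walk_state lo hi bl br dl dr E ->
  let E' := E `&` [set w | step (lo - 1) w = -1] `&`
              [set w | B (tree_edges (t (dl - 1) w))] in
  walk_state (lo - 1) hi (bl + 1) br (dl - 1) dr E' /\
  Pr E' = 2^-1 * Pr [set w | B (tree_edges (t (dl - 1) w))] * Pr E.
Proof.
move=> [lh dd cE sE] E'.
have [| | | |||cE1 p1] := @cylinder_cap lo hi dl dr (lo - 1) hi dl dr E
  (inr (lo - 1)) [set w | step (lo - 1) w = -1] _ _ _ _ cE (step_event _ (-1));
  rewrite /=; try lia.
have [| | | |||cE2 p2'] := @cylinder_cap (lo - 1) hi dl dr (lo - 1) hi (dl - 1) dr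
  _ (inl (inl (dl - 1))) _ _ _ _ _ cE1 (size_event (dl - 1) B);
  rewrite /=; try lia.
split; last by rewrite p2' p1 pr_step//; ring.
split => //; [lia|lia|].
move=> w [[/sE[bl_ br_ dl_ dr_] st] _]; split => //.
  by move: st; rewrite /= /step subrK; lia.
have := graftS_w (lo - 1) w; rewrite subrK dl_ down_stepE st eqxx /=; lia.
Qed.

(** What a bridge needs to know of position [i]: the step, and the size of the tree
    grafted there if there is one ([0] otherwise). *)
Definition mark (i : int) (w : Omega) : int * nat :=
  (step i w, if down i w then tree_edges (t (graft i w) w) else 0%N).

Lemma discrete_down i : discrete_rv (fun w => down i w).
Proof.
have := discrete_comp (discrete_step i) (fun s => s == -1).
by congr discrete_rv; apply/funext => w; rewrite /= down_stepE.
Qed.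

Lemma discrete_graft i : discrete_rv (fun w => graft i w).
Proof.
have pos n : discrete_rv (fun w => graft (Posz n) w).
  elim: n => [|n IH].
    have := discrete_comp (discrete_down 0) (fun=> 0 : int).
    by congr discrete_rv; apply/funext => w; rewrite /= big_ord0.
  have := discrete_comp (discrete_pair IH (discrete_down (Posz n)))
    (fun xy : int * bool => xy.1 + Posz xy.2).
  congr discrete_rv; apply/funext => w.
  have -> : Posz n.+1 = Posz n + 1 by lia.
  by rewrite graftS_w.
have neg n : discrete_rv (fun w => graft (- Posz n) w).
  elim: n => [|n IH]; first by rewrite oppr0; exact: pos.
  have := discrete_comp (discrete_pair IH (discrete_down (- Posz n.+1)))
    (fun xy : int * bool => xy.1 - Posz xy.2).
  congr discrete_rv; apply/funext => w /=.
  have -> : - Posz n = - Posz n.+1 + 1 by lia.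
  by rewrite graftS_w addrK.
by case: i => n; [exact: pos|rewrite NegzE; exact: neg].
Qed.

Lemma discrete_mark i : discrete_rv (mark i).
Proof.
have dsize : discrete_rv (fun w => tree_edges (t (graft i w) w)).
  apply: (discrete_bind (discrete_graft i)
    (Y := fun m w => tree_edges (t m w))) => m B.
  exact: tree_rv enc m [set T | B (tree_edges T)].
have dX := discrete_pair (discrete_step i) (discrete_pair (discrete_down i) dsize).
exact: (discrete_comp dX (fun x => (x.1, if x.2.1 then x.2.2 else 0%N))).
Qed.

(** The marks at positions from [- N] to [N - 1]. *)
Fixpoint past (N : nat) (w : Omega) : seq ((int * nat) * (int * nat)) :=
  if N is N'.+1 then (mark (Posz N') w, mark (Negz N') w) :: past N' w else [::].

Lemma discrete_past N : discrete_rv (past N).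
Proof.
elim: N => [|N IH].
  exact: (discrete_comp (discrete_mark 0) (fun=> [::])).
have dX := discrete_pair (discrete_mark (Posz N))
  (discrete_pair (discrete_mark (Negz N)) IH).
exact: (discrete_comp dX (fun x => (x.1, x.2.1) :: x.2.2)).
Qed.

Lemma pr_step_other i x : x \notin [:: -1; 1] -> Pr [set w | step i w = x] = 0.
Proof.
rewrite !inE negb_or => /andP[/eqP x1 /eqP x2].
have mS y : measurable [set w | step i w = y] by exact: discrete_step i [set y].
have mU := measurableU _ _ (mS (-1)) (mS 1).
have := @pr_le _ _ _ P _ setT (measurableU _ _ (mS x) mU) measurableT (fun _ _ => I).
rewrite pr_setT prU//; last first.
  apply/seteqP; split => // w [/= ->] [] /=; lia.
rewrite (prU _ (mS (-1)) (mS 1)); last first.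
  by apply/seteqP; split => // w [/= ->]; lia.
rewrite (@pr_step i (-1) isT) (@pr_step i 1 isT) => le.
by apply/eqP; rewrite eq_le pr_ge0 andbT; lra.
Qed.

Lemma state_measurable lo hi bl br dl dr E :
  walk_state lo hi bl br dl dr E -> measurable E.
Proof. by move=> [_ _ /cylinder_measurable]. Qed.

Let measurable_mark i a : measurable [set w | mark i w = a].
Proof. exact: discrete_mark i [set a]. Qed.

Lemma pr_mark_other i (a : int * nat) E : measurable E ->
  a.1 \notin [:: -1; 1] -> Pr (E `&` [set w | mark i w = a]) = 0.
Proof.
move=> mE a1; apply/eqP; rewrite eq_le pr_ge0 andbT -(pr_step_other i a1).
apply: pr_le; [exact: measurableI|exact: discrete_step i [set _]|].
by move=> w [_ /= <-].
Qed.

Lemma mark_up i e w : (mark i w == (1, e)) = (step i w == 1) && (e == 0%N).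
Proof.
rewrite /mark down_stepE xpair_eqE; case: eqVneq => //= ->.
by rewrite eq_sym.
Qed.

Lemma mark_down i e w : (mark i w == (-1, e)) =
  (step i w == -1) && (tree_edges (t (graft i w) w) == e).
Proof. by rewrite /mark down_stepE xpair_eqE; case: eqVneq. Qed.

Lemma state_right_mark lo hi bl br dl dr E a :
  walk_state lo hi bl br dl dr E ->
  Pr (E `&` [set w | mark hi w = a]) = 0 \/
  exists br' dr', [/\ br - 1 <= br', br' <= br + 1 &
    walk_state lo (hi + 1) bl br' dl dr' (E `&` [set w | mark hi w = a])].
Proof.
move=> sE; have mE := state_measurable sE.
have [a1|a1] := boolP (a.1 \in [:: -1; 1]); last by left; exact: pr_mark_other.
case: a a1 => s e; rewrite !inE => /orP[]/eqP /= ->; last first.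
  have [e0|e0] := eqVneq e 0%N; last first.
    left; rewrite (_ : _ `&` _ = set0) ?pr_set0//.
    apply/seteqP; split => // w [_ /= /eqP]; rewrite mark_up (negPf e0) andbF.
    by [].
  right; exists (br + 1), dr; split; [lia|lia|].
  have [+ _] := state_right_up sE; congr walk_state; congr setI.
  by apply/seteqP; split => w /= /eqP; rewrite ?mark_up e0 ?andbT => H; apply/eqP;
     rewrite ?mark_up ?andbT.
right; exists (br - 1), (dr + 1); split; [lia|lia|].
have [+ _] := state_right_down [set e] sE; congr walk_state.
have [_ _ _ gE] := sE.
apply/seteqP; split => w.
  move=> [[Ew st] tw]; split => //=; apply/eqP; rewrite mark_down st eqxx/=.
  by have [_ _ _ ->] := gE w Ew; apply/eqP.
move=> [Ew /= /eqP]; rewrite mark_down; have [_ _ _ ->] := gE w Ew.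
by move=> /andP[/eqP ? /eqP ?].
Qed.

Lemma state_left_mark lo hi bl br dl dr E a :
  walk_state lo hi bl br dl dr E ->
  Pr (E `&` [set w | mark (lo - 1) w = a]) = 0 \/
  exists bl' dl', [/\ bl - 1 <= bl', bl' <= bl + 1 &
    walk_state (lo - 1) hi bl' br dl' dr (E `&` [set w | mark (lo - 1) w = a])].
Proof.
move=> sE; have mE := state_measurable sE.
have [a1|a1] := boolP (a.1 \in [:: -1; 1]); last by left; exact: pr_mark_other.
case: a a1 => s e; rewrite !inE => /orP[]/eqP /= ->; last first.
  have [e0|e0] := eqVneq e 0%N; last first.
    left; rewrite (_ : _ `&` _ = set0) ?pr_set0//.
    apply/seteqP; split => // w [_ /= /eqP]; rewrite mark_up (negPf e0) andbF.
    by [].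
  right; exists (bl - 1), dl; split; [lia|lia|].
  have [+ _] := state_left_up sE; congr walk_state; congr setI.
  by apply/seteqP; split => w /= /eqP; rewrite ?mark_up e0 ?andbT => H; apply/eqP;
     rewrite ?mark_up ?andbT.
right; exists (bl + 1), (dl - 1); split; [lia|lia|].
have [+ _] := state_left_down [set e] sE; congr walk_state.
have [_ _ _ gE] := sE.
have gl w : E w -> step (lo - 1) w = -1 -> graft (lo - 1) w = dl - 1.
  move=> /gE[_ _ gl _] st.
  by have := graftS_w (lo - 1) w; rewrite subrK gl down_stepE st eqxx /=; lia.
apply/seteqP; split => w.
  move=> [[Ew st] tw]; split => //=; apply/eqP; rewrite mark_down gl// st eqxx/=.
  exact/eqP.
move=> [Ew /= /eqP]; rewrite mark_down => /andP[/eqP st].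
by rewrite gl// => /eqP.
Qed.

(** Each value of the past is a cylinder of the exploration, up to null events due to
    steps other than [1] and [-1]. *)
Lemma past_state (N : nat) x :
  Pr [set w | past N w = x] = 0 \/
  exists bl br dl dr, [/\ - Posz N <= bl <= Posz N, - Posz N <= br <= Posz N &
    walk_state (- Posz N) (Posz N) bl br dl dr [set w | past N w = x]].
Proof.
elim: N x => [|N IH] [|[a a'] x] /=.
- right; exists 0, 0, 0, 0; split => //; rewrite oppr0; split => //.
    rewrite (_ : [set _ | _] = setT); first exact: cylinder_setT.
    by apply/seteqP; split.
  by move=> w _; rewrite (walk0 enc) /= big_ord0.
- by left; rewrite (_ : [set _ | _] = set0) ?pr_set0//; apply/seteqP; split.
- by left; rewrite (_ : [set _ | _] = set0) ?pr_set0//; apply/seteqP; split.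
have -> : [set w | (mark N w, mark (Negz N) w) :: past N w = (a, a') :: x] =
    [set w | past N w = x] `&` [set w | mark N w = a] `&`
    [set w | mark (Negz N) w = a'].
  by apply/seteqP; split => w /=; [move=> [-> -> ->]|move=> [[-> ->] ->]].
have le0 A B : measurable A -> measurable B -> Pr A = 0 -> Pr (A `&` B) = 0.
  move=> mA mB A0; apply/eqP; rewrite eq_le pr_ge0 andbT -A0.
  by apply: pr_le (measurableI _ _ mA mB) mA _ => w [].
have mp : measurable [set w | past N w = x] by exact: discrete_past N [set x].
have [p0'|[bl [br [dl [dr [blN brN sE]]]]]] := IH x.
  by left; rewrite -setIA; apply: le0 => //; exact: measurableI.
have [p0'|[br' [dr' [br1 br2 sE']]]] := state_right_mark a sE.
  by left; apply: le0 => //; exact: measurableI.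
have eN : Negz N = - Posz N - 1 by rewrite NegzE; lia.
have [p0'|[bl' [dl' [bl1 bl2 sE'']]]] := state_left_mark a' sE'.
  by left; rewrite eN.
right; exists bl', br', dl', dr'; split; [lia|lia|].
rewrite eN; have -> : - Posz N.+1 = - Posz N - 1 by lia.
by have -> : Posz N.+1 = Posz N + 1 by lia.
Qed.

(** The condition of [is_bridge] on the tree grafted at [i]. *)
Definition fits (l i : int) (w : Omega) : bool :=
  let m := mark i w in
  (m.1 == 1) || (m.1 == -1) && (m.2 <= `|b i w - l|.-2)%N.

(** The walk from [i] to the right comes down to [l] within [j] steps, and the trees
    met on the way fit in a bridge of level [l]. *)
Fixpoint run_right (j : nat) (i l : int) (w : Omega) : bool :=
  (b i w == l) ||
  (if j is j'.+1 then [&& l < b i w, fits l i w & run_right j' (i + 1) l w]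
   else false).

Fixpoint run_left (j : nat) (i l : int) (w : Omega) : bool :=
  (b i w == l) ||
  (if j is j'.+1 then [&& l < b i w, fits l (i - 1) w & run_left j' (i - 1) l w]
   else false).

Lemma discrete_fits l i : discrete_rv (fits l i).
Proof.
have dX := discrete_pair (walk_rv enc i) (discrete_mark i).
exact: (discrete_comp dX (fun x =>
  (x.2.1 == 1) || (x.2.1 == -1) && (x.2.2 <= `|x.1 - l|.-2)%N)).
Qed.

Lemma discrete_run_right j i l : discrete_rv (run_right j i l).
Proof.
elim: j i => [|j IH] i.
  exact: (discrete_comp (walk_rv enc i) (fun x => (x == l) || false)).
have dX := discrete_pair (walk_rv enc i)
  (discrete_pair (discrete_fits l i) (IH (i + 1))).
exact: (discrete_comp dX (fun x => (x.1 == l) || [&& l < x.1, x.2.1 & x.2.2])).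
Qed.

Lemma discrete_run_left j i l : discrete_rv (run_left j i l).
Proof.
elim: j i => [|j IH] i.
  exact: (discrete_comp (walk_rv enc i) (fun x => (x == l) || false)).
have dX := discrete_pair (walk_rv enc i)
  (discrete_pair (discrete_fits l (i - 1)) (IH (i - 1))).
exact: (discrete_comp dX (fun x => (x.1 == l) || [&& l < x.1, x.2.1 & x.2.2])).
Qed.

Let measurable_right j i l : measurable [set w | run_right j i l w].
Proof. exact: discrete_run_right j i l [set true]. Qed.

Let measurable_left j i l : measurable [set w | run_left j i l w].
Proof. exact: discrete_run_left j i l [set true]. Qed.

Let small := small_prob p.

Lemma small_ge0 k : 0 <= small k.
Proof. by rewrite /small /small_prob le_max; apply/orP; left; move: p2; lra. Qed.

Lemma pr_size_ge m k : small k <= Pr [set w | (tree_edges (t m w) <= k)%N].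
Proof.
have mk : measurable [set w | (tree_edges (t m w) <= k)%N].
  exact: tree_rv enc m [set T | (tree_edges T <= k)%N].
have := small_prob_le p0 p2 (tree_rv enc m) (tree_law enc m) k.
by rewrite prE// lee_fin.
Qed.

(** Read to the right, a step from height [h] to [h - 1] meets a tree rooted at height
    [h]; read to the left, a step from height [h] to [h + 1] meets a tree rooted at
    height [h + 1].  A tree rooted at height [h] fits if it has at most [h - 2]
    edges, hence [h.-2] to the right and [h.-1] to the left. *)
Definition hit_right := hit (fun=> 1) (fun h => small h.-2).
Definition hit_left := hit (fun h => small h.-1) (fun=> 1).

Lemma hit_right_ge0 j h : 0 <= hit_right j h.
Proof.
elim: j h => [|j IH] [|h] //; rewrite /hit_right /= mulr_ge0// addr_ge0//.
  by rewrite mul1r; exact: IH.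
by rewrite mulr_ge0// ?small_ge0//; exact: IH.
Qed.

Lemma hit_left_ge0 j h : 0 <= hit_left j h.
Proof.
elim: j h => [|j IH] [|h] //; rewrite /hit_left /= mulr_ge0// addr_ge0//.
  by rewrite mulr_ge0// ?small_ge0//; exact: IH.
by rewrite mul1r; exact: IH.
Qed.

(** The event [G] stands for the run to the left, whose conditional probability is not
    affected by what is explored on the right. *)
Lemma pr_run_right (l lo bl dl : int) (G : set Omega) (g : R) :
  measurable G -> 0 <= g ->
  (forall hi br dr E, walk_state lo hi bl br dl dr E -> g * Pr E <= Pr (E `&` G)) ->
  forall j h hi dr E, walk_state lo hi bl (l + Posz h) dl dr E ->
  hit_right j h * (g * Pr E) <= Pr (E `&` [set w | run_right j hi l w] `&` G).
Proof.
move=> mG g0 gE.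
have base j hi dr E : walk_state lo hi bl (l + 0) dl dr E ->
    1 * (g * Pr E) <= Pr (E `&` [set w | run_right j hi l w] `&` G).
  move=> sE; rewrite mul1r; apply: le_trans (gE _ _ _ _ sE) _.
  have mE := state_measurable sE; have [_ _ _ bE] := sE.
  apply: pr_le; [exact: measurableI|by apply: measurableI => //; exact: measurableI|].
  move=> w [Ew Gw]; split => //; split => //=; have [_ bh _ _] := bE w Ew.
  by case: j => /=; rewrite bh addr0 eqxx.
elim=> [|j IH] [|h] hi dr E sE; try exact: base sE.
  by rewrite [hit_right _ _]/= mul0r pr_ge0.
have mE := state_measurable sE; have [_ _ _ bE] := sE.
have [s1 p1] := state_right_up sE.
have [s2 p2'] := state_right_down [set e | (e <= h.-1)%N] sE.
move: s1 s2 p1 p2'; set E1 := E `&` _; set E2 := E `&` _ `&` _ => s1 s2 p1 p2'.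
have -> : hit_right j.+1 h.+1 =
    2^-1 * (1 * hit_right j h.+2 + small h.-1 * hit_right j h) by [].
rewrite (_ : l + h.+1 + 1 = l + h.+2) in s1; last by lia.
rewrite (_ : l + h.+1 - 1 = l + h) in s2; last by lia.
have := IH _ _ _ _ s1; have := IH _ _ _ _ s2; rewrite p1 p2'.
set A1 := E1 `&` _ `&` _; set A2 := E2 `&` _ `&` _ => le2 le1.
have mA1 : measurable A1.
  by apply: measurableI => //; apply: measurableI => //; exact: state_measurable s1.
have mA2 : measurable A2.
  by apply: measurableI => //; apply: measurableI => //; exact: state_measurable s2.
have : Pr A1 + Pr A2 <= Pr (E `&` [set w | run_right j.+1 hi l w] `&` G).
  rewrite -prU//; last first.
    apply/seteqP; split => // w [[[[_ st1] _] _] [[[[_ st2] _] _] _]].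
    by move: st1 st2 => /= -> ; lia.
  apply: pr_le; [exact: measurableU| |].
    by apply: measurableI => //; exact: measurableI.
  move=> w [[[[Ew st] rw] Gw]|[[[[Ew st] tw] rw] Gw]]; split => //; split => //=.
    have [_ bh _ _] := bE w Ew; apply/orP; right; apply/and3P; split => //.
      by rewrite bh; lia.
    by rewrite /fits /= (eqP (introT eqP st)) eqxx.
  have [_ bh _ gr] := bE w Ew; apply/orP; right; apply/and3P; split => //.
    by rewrite bh; lia.
  rewrite /fits /= down_stepE st eqxx/= gr bh; apply: leq_trans tw _; lia.
apply: le_trans.
have Q0 : 0 <= g * Pr E by rewrite mulr_ge0 ?pr_ge0.
have := ler_wpM2r Q0 (ler_wpM2r (hit_right_ge0 j h) (pr_size_ge dr h.-1)).
move: le1 le2; rewrite /=; lra.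
Qed.

Lemma pr_run_left (l hi br dr : int) j h lo dl E :
  walk_state lo hi (l + Posz h) br dl dr E ->
  hit_left j h * Pr E <= Pr (E `&` [set w | run_left j lo l w]).
Proof.
have base j' lo' dl' E' : walk_state lo' hi (l + 0) br dl' dr E' ->
    1 * Pr E' <= Pr (E' `&` [set w | run_left j' lo' l w]).
  move=> sE; have mE := state_measurable sE; have [_ _ _ bE] := sE.
  rewrite mul1r; apply: pr_le => //; first exact: measurableI.
  move=> w Ew; split => //=; have [bl _ _ _] := bE w Ew.
  by case: j' => /=; rewrite bl addr0 eqxx.
elim: j h lo dl E => [|j IH] [|h] lo dl E sE; try exact: base sE.
  by rewrite [hit_left _ _]/= mul0r pr_ge0.
have mE := state_measurable sE; have [_ _ _ bE] := sE.
have [s1 p1] := state_left_up sE.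
have [s2 p2'] := state_left_down [set e | (e <= h)%N] sE.
move: s1 s2 p1 p2'; set E1 := E `&` _; set E2 := E `&` _ `&` _ => s1 s2 p1 p2'.
have -> : hit_left j.+1 h.+1 =
    2^-1 * (small h * hit_left j h.+2 + 1 * hit_left j h) by [].
rewrite (_ : l + h.+1 - 1 = l + h) in s1; last by lia.
rewrite (_ : l + h.+1 + 1 = l + h.+2) in s2; last by lia.
have := IH _ _ _ _ s1; have := IH _ _ _ _ s2; rewrite p1 p2'.
set A1 := E1 `&` _; set A2 := E2 `&` _ => le2 le1.
have mA1 : measurable A1 by apply: measurableI => //; exact: state_measurable s1.
have mA2 : measurable A2 by apply: measurableI => //; exact: state_measurable s2.
have : Pr A1 + Pr A2 <= Pr (E `&` [set w | run_left j.+1 lo l w]).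
  rewrite -prU//; last first.
    apply/seteqP; split => // w [[[_ st1] _] [[[_ st2] _] _]].
    by move: st1 st2 => /= -> ; lia.
  apply: pr_le; [exact: measurableU|exact: measurableI|].
  move=> w [[[Ew st] rw]|[[[Ew st] tw] rw]]; split => //=.
    have [bl _ _ _] := bE w Ew; apply/orP; right; apply/and3P; split => //.
      by rewrite bl; lia.
    by rewrite /fits /= (eqP (introT eqP st)) eqxx.
  have [bl _ gl _] := bE w Ew; apply/orP; right; apply/and3P; split => //.
    by rewrite bl; lia.
  have gl1 : graft (lo - 1) w = dl - 1.
    by have := graftS_w (lo - 1) w; rewrite subrK gl down_stepE st eqxx /=; lia.
  rewrite /fits /= down_stepE st eqxx/= gl1; apply: leq_trans tw _.
  by move: st; rewrite /= /step subrK bl; lia.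
apply: le_trans.
have Q0 := pr_ge0 P E.
have := ler_wpM2r Q0 (ler_wpM2r (hit_left_ge0 j h.+2) (pr_size_ge (dl - 1) h)).
move: le1 le2; rewrite /=; lra.
Qed.

Let rho := tree_rate p.
Let rho_gt0 : 0 < rho. Proof. exact: tree_rate_gt0 p0 p2. Qed.
Let rho_lt1 : rho < 1. Proof. exact: tree_rate_lt1 p2. Qed.
Let C := (rho * (1 - rho))^-1.

Let C0 : 0 <= C.
Proof.
by rewrite invr_ge0; apply: mulr_ge0; rewrite ?subr_ge0; exact: ltW.
Qed.

(** The shift by two absorbs the truncated predecessors of [hit_right] and
    [hit_left]. *)
Let small_tail k h : (h <= k.+2)%N -> 1 - small k <= C * rho ^+ h.
Proof.
move=> hk; apply: (@le_trans _ _ (C * rho ^+ k.+2)); last first.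
  rewrite ler_wpM2l//.
  exact: ler_wiXn2l (ltW rho_gt0) (ltW rho_lt1) _ _ hk.
have : 1 - rho / (1 - rho) * rho ^+ k <= small k.
  by rewrite /small /small_prob le_max lexx orbT.
have -> : C * rho ^+ k.+2 = rho / (1 - rho) * rho ^+ k.
  rewrite /C !exprS; field; rewrite gt_eqF ?subr_eq0 ?gt_eqF//=.
  by rewrite subr_gt0.
by rewrite lerBlDr -lerBlDl.
Qed.

Let small_ge k : 1 - p <= small k.
Proof. by rewrite /small /small_prob le_max lexx. Qed.

Let small_le1 k : small k <= 1.
Proof.
rewrite /small /small_prob ge_max; apply/andP; split; first by move: p0; lra.
rewrite gerBl; apply: mulr_ge0; last by apply: exprn_ge0; exact: ltW.
by apply: divr_ge0; rewrite ?subr_ge0; exact: ltW.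
Qed.

Lemma hit_right_lower : exists2 c : R, 0 < c &
  forall H, exists J, forall h, (h <= H)%N -> c <= hit_right J h.
Proof.
apply: (@hit_lower R (fun=> 1) (fun h => small h.-2) C rho (1 - p)) => //.
- by move: p2; lra.
- by move=> h; rewrite subrr mulr_ge0// exprn_ge0// ltW.
- by move=> h; apply: small_tail; case: h => [|[]].
Qed.

Lemma hit_left_lower : exists2 c : R, 0 < c &
  forall H, exists J, forall h, (h <= H)%N -> c <= hit_left J h.
Proof.
apply: (@hit_lower R (fun h => small h.-1) (fun=> 1) C rho (1 - p)) => //.
- by move=> h; exact: small_ge0.
- by move=> _; move: p0; lra.
- by move: p2; lra.
- by move=> h; apply: small_tail; case: h.
- by move=> h; rewrite subrr mulr_ge0// exprn_ge0// ltW.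
Qed.

(** * Bridges at every scale *)

Definition saturated (N : nat) (D : set Omega) : Prop :=
  forall w w', past N w = past N w' -> D w -> D w'.

Lemma saturated_measurable N D : saturated N D -> measurable D.
Proof.
move=> sD; have -> : D = past N @^-1` (past N @` D).
  apply/seteqP; split => w; first by move=> Dw; exists w.
  by move=> [w' Dw' /sD]; apply.
exact: discrete_past.
Qed.

Lemma past_le M N w w' : (M <= N)%N -> past N w = past N w' -> past M w = past M w'.
Proof.
move=> /subnK <-; elim: (N - M)%N => [//|n IH].
by rewrite addSn => /(congr1 behead)/IH.
Qed.

Lemma saturated_le M N D : (M <= N)%N -> saturated M D -> saturated N D.
Proof. by move=> MN sD w w' /(past_le MN)/sD. Qed.

Lemma past_mark N w w' (i : int) : past N w = past N w' ->
  - Posz N <= i -> i < Posz N -> mark i w = mark i w'.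
Proof.
elim: N => [|N IH]; first by rewrite oppr0; lia.
move=> e i1 i2; have e3 := congr1 behead e.
have e0 := congr1 (head ((0, 0%N), (0, 0%N) : int * nat)) e.
have e1 : mark N w = mark N w' by exact: (congr1 fst e0).
have e2 : mark (Negz N) w = mark (Negz N) w' by exact: (congr1 snd e0).
have [->//|iN] := eqVneq i (Posz N).
have [->//|iN'] := eqVneq i (Negz N).
by apply: IH => //; lia.
Qed.

Lemma walk_mark i w : b (i + 1) w = b i w + (mark i w).1.
Proof. by rewrite /mark /= /step addrCA subrr addr0. Qed.

Lemma past_walk N w w' (i : int) : past N w = past N w' ->
  - Posz N <= i -> i <= Posz N -> b i w = b i w'.
Proof.
move=> e.
have right n : (n <= N)%N -> b (Posz n) w = b (Posz n) w'.
  elim: n => [|n IH] nN; first by rewrite !(walk0 enc).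
  have -> : Posz n.+1 = Posz n + 1 by lia.
  by rewrite !walk_mark IH ?(ltnW nN)// (past_mark e)//; lia.
have left n : (n <= N)%N -> b (- Posz n) w = b (- Posz n) w'.
  elim: n => [|n IH] nN; first by rewrite oppr0 !(walk0 enc).
  apply: (@addIr _ (mark (- Posz n.+1) w).1).
  rewrite -walk_mark [in RHS](past_mark e) -?walk_mark; [|lia|lia].
  have -> : - Posz n.+1 + 1 = - Posz n by lia.
  exact: IH (ltnW nN).
case: i => n i1 i2; first by apply: right; lia.
by rewrite NegzE; apply: left; lia.
Qed.

Lemma past_fits N w w' l i : past N w = past N w' ->
  - Posz N <= i -> i < Posz N -> fits l i w = fits l i w'.
Proof.
move=> e i1 i2; rewrite /fits (past_mark e)// (past_walk e)//; exact: ltW.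
Qed.

Lemma past_run_right N w w' j i l : past N w = past N w' ->
  - Posz N <= i -> i + Posz j <= Posz N -> run_right j i l w = run_right j i l w'.
Proof.
move=> e; elim: j i => [|j IH] i i1 i2 /=; first by rewrite (past_walk e)//; lia.
rewrite (past_walk e) ?(past_fits l e) ?(IH (i + 1))//; lia.
Qed.

Lemma past_run_left N w w' j i l : past N w = past N w' ->
  - Posz N <= i - Posz j -> i <= Posz N -> run_left j i l w = run_left j i l w'.
Proof.
move=> e; elim: j i => [|j IH] i i1 i2 /=; first by rewrite (past_walk e)//; lia.
rewrite (past_walk e) ?(past_fits l e) ?(IH (i - 1))//; lia.
Qed.

Lemma run_rightP j i l w : run_right j i l w -> exists T : int,
  [/\ i <= T, b T w = l &
      forall k : int, i <= k -> k < T -> l < b k w /\ fits l k w].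
Proof.
elim: j i => [|j IH] i /= /orP[/eqP bi|//]; try by exists i; split => // k; lia.
move=> /and3P[li fi /IH[T [iT bT HT]]]; exists T; split => //; first by lia.
move=> k ik kT; have [->//|ne] := eqVneq k i.
by apply: HT => //; lia.
Qed.

Lemma run_leftP j i l w : run_left j i l w -> exists S : int,
  [/\ S <= i, b S w = l, forall k : int, S < k -> k <= i -> l < b k w &
      forall k : int, S <= k -> k < i -> fits l k w].
Proof.
elim: j i => [|j IH] i /= /orP[/eqP bi|//]; try by exists i; split => // k; lia.
move=> /and3P[li fi /IH[S [iS bS HS HS']]]; exists S; split => //; first by lia.
  move=> k Sk ki; have [->//|ne] := eqVneq k i.
  by apply: HS => //; lia.
move=> k Sk ki; have [->//|ne] := eqVneq k (i - 1).
by apply: HS' => //; lia.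
Qed.

(** Bounds the sizes of the trees already explored; a sufficiently low level [l] then
    accommodates them in a bridge of level [l]. *)
Definition light (K N : nat) (w : Omega) : bool :=
  all (fun a => (a.1.2 <= K)%N && (a.2.2 <= K)%N) (past N w).

Lemma light_mark K N w (i : int) : light K N w ->
  - Posz N <= i -> i < Posz N -> ((mark i w).2 <= K)%N.
Proof.
elim: N => [|N IH]; first by rewrite oppr0; lia.
rewrite /light [past _ w]/= /all -/all => /andP[/andP[m1 m2] lN] i1 i2.
have [->//|iN] := eqVneq i (Posz N).
have [->//|iN'] := eqVneq i (Negz N).
by apply: IH => //; lia.
Qed.

Lemma light_likely N (e : R) : 0 < e ->
  exists K, Pr (~` [set w | light K N w]) <= e.
Proof.
move=> e0; pose A K := [set w | light K N w].
have mA K : measurable (A K) by exact: discrete_past N [set x | all _ x].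
have ndA : nondecreasing_seq A.
  move=> K K' KK'; apply/subsetPset => w; apply: sub_all => a /andP[a1 a2].
  by rewrite (leq_trans a1)// (leq_trans a2).
have AT : \bigcup_K A K = setT.
  apply/seteqP; split => // w _; rewrite /bigcup /A /light /=.
  elim: (past N w) => [|a s [K _ /= IH]]; first by exists 0%N.
  exists (maxn K (maxn a.1.2 a.2.2)) => //=; rewrite !leq_max !leqnn !orbT/=.
  by apply: sub_all IH => a' /andP[a1 a2]; rewrite !leq_max a1 a2.
have : P (A K) @[K --> \oo] --> 1%:E.
  rewrite -[1%:E](probability_setT P) -AT; apply: nondecreasing_cvg_mu => //.
  by rewrite AT.
move=> /fine_cvg/cvgrPdist_le/(_ e e0)[K _ /(_ K (leqnn K))] /= HK.
exists K; rewrite prC; last exact: mA.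
by apply: le_trans HK; rewrite /pr ler_norm.
Qed.

Definition steps_pm (w : Omega) : Prop := forall i, step i w \in [:: -1; 1].

Lemma steps_pm_walk w (i : int) : steps_pm w ->
  b (i + 1) w = b i w + 1 \/ b (i + 1) w = b i w - 1.
Proof.
move=> /(_ i); rewrite !inE => /orP[]/eqP/(canRL (subrK _)) ->; rewrite addrC.
  by right.
by left.
Qed.

Lemma walk_le w (i : int) : steps_pm w -> `|b i w| <= `|i|.
Proof.
move=> st; have stE k := steps_pm_walk k st.
have right n : `|b (Posz n) w| <= Posz n.
  elim: n => [|n IH]; first by rewrite (walk0 enc).
  have -> : Posz n.+1 = Posz n + 1 by lia.
  by have := stE (Posz n); lia.
have left n : `|b (- Posz n) w| <= Posz n.
  elim: n => [|n IH]; first by rewrite oppr0 (walk0 enc).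
  have := stE (- Posz n.+1).
  have -> : - Posz n.+1 + 1 = - Posz n by lia.
  by move=> st'; lia.
by case: i => n; [exact: right|rewrite NegzE; have := left n.+1; lia].
Qed.

Definition bridge_beyond (N : nat) (w : Omega) : Prop := exists l lo hi : int,
  [/\ lo <= - Posz N, Posz N <= hi, l <= - Posz N &
      is_bridge (t ^~ w) (b ^~ w) l lo hi].

Lemma bridge_beyond_le M N w : (M <= N)%N -> bridge_beyond N w -> bridge_beyond M w.
Proof.
move=> MN [l [lo [hi [h1 h2 h3 h4]]]].
by exists l, lo, hi; split => //; lia.
Qed.

Lemma runs_bridge (N K : nat) (l : int) j j' w : steps_pm w ->
  l < - (Posz N + Posz K + 2) ->
  run_right j (Posz N) l w -> run_left j' (- Posz N) l w -> light K N w ->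
  bridge_beyond N w.
Proof.
move=> st lN /run_rightP[T [NT bT HT]] /run_leftP[S [SN bS HS HS']] lK.
exists l, S, T; split => //; first by lia.
split => // i.
  move=> Si iT; have [iN|iN] := leP i (- Posz N); first exact: HS.
  have [iN'|iN'] := leP (Posz N) i; first by have [] := HT i iN' iT.
  by have := @walk_le w i st; lia.
move=> Si iT di.
have fitsE : fits l i w -> (tree_edges (t (graft i w) w) <= `|b i w - l|.-2)%N.
  move: (di); rewrite /fits /mark /= down_stepE => /eqP ->.
  by rewrite eqxx.
have [iN|iN] := ltP i (- Posz N); first by apply: fitsE; exact: HS'.
have [iN'|iN'] := leP (Posz N) i; first by apply: fitsE; have [] := HT i iN' iT.
have := light_mark lK iN iN'; rewrite /mark/= di => /leq_trans; apply.
by have := @walk_le w i st; lia.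
Qed.

Let stage_window (N J1 J2 : nat) : let M := (N + J1 + J2)%N in
  [/\ (N <= M)%N, - Posz M <= Posz N, Posz N + Posz J1 <= Posz M,
      - Posz M <= - Posz N - Posz J2 & - Posz N <= Posz M].
Proof. by split; lia. Qed.

Let stage_height (N K : nat) (x : int) : - Posz N <= x <= Posz N ->
  let l := - (Posz N + Posz K + 3) in
  x = l + Posz `|x - l|%N /\ (`|x - l| <= N + N + K + 3)%N.
Proof. by move=> xN l; rewrite /l; lia. Qed.

(** Given the past, with probability at least [c] both runs from the explored window
    succeed and close a bridge around it; the error [e] accounts for the trees
    inside the window, which are small enough once [l] is low enough.  The constant
    [c] does not depend on the scale, as the walk has to come from far away in any
    case. *)
Lemma bridge_stage : exists2 c : R, 0 < c <= 1 & forall (N : nat) (e : R), 0 < e ->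
  exists N' A, [/\ (N <= N')%N, saturated N' A,
    forall D, saturated N D -> Pr (D `\` A) <= (1 - c) * Pr D + e &
    forall w, steps_pm w -> A w -> bridge_beyond N w].
Proof.
have [c1 c1_gt0 H1] := hit_right_lower; have [c2 c2_gt0 H2] := hit_left_lower.
have c1_le1 : c1 <= 1 by have [[|J] /(_ 0%N isT)] := H1 0%N.
have c2_le1 : c2 <= 1 by have [[|J] /(_ 0%N isT)] := H2 0%N.
exists (c1 * c2); first by rewrite mulr_gt0//= mulr_ile1// ltW.
move=> N e e0; have [K BK] := light_likely N e0.
pose l : int := - (Posz N + Posz K + 3).
have level : l < - (Posz N + Posz K + 2) by rewrite ltrN2 ltrD2l.
have [J1 HJ1] := H1 (N + N + K + 3)%N; have [J2 HJ2] := H2 (N + N + K + 3)%N.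
pose Z := [set w | run_right J1 N l w] `&` [set w | run_left J2 (- Posz N) l w].
have mZ : measurable Z by exact: measurableI.
pose B := [set w | light K N w].
have mB : measurable B by exact: discrete_past N [set x | all _ x].
have [NM w1 w2 w3 w4] := stage_window N J1 J2.
exists (N + J1 + J2)%N, (Z `&` B); split.
- exact: NM.
- move=> w w' e' [[/= r1 r2] lw]; split; first split => /=.
  + by rewrite -(past_run_right l e' w1 w2).
  + by rewrite -(past_run_left l e' w3 w4).
  + by rewrite /B /= /light -(past_le NM e').
- move=> D sD; have mD := saturated_measurable sD.
  apply: (@le_trans _ _ (Pr (D `\` Z) + Pr (~` B))).
    apply: le_trans (pr_leU _ _ _); [|exact: measurableD|exact: measurableC].
    apply: pr_le.
    + by apply: measurableD => //; exact: measurableI.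
    + by apply: measurableU; [exact: measurableD|exact: measurableC].
    + move=> w [Dw nZB]; have [Zw|nZ] := pselect (Z w); last by left.
      by right => Bw; apply: nZB.
  apply: lerD => //.
  apply: (pr_le_by_value (discrete_past N)) => //.
  + by rewrite subr_ge0 mulr_ile1// ltW.
  + exact: measurableD.
  move=> x; set E := [set w | past N w = x].
  have mE : measurable E by exact: discrete_past N [set x].
  have [[w0 [Dw0 Ew0]]|noD] := pselect (exists w, D w /\ E w); last first.
    have -> : (D `\` Z) `&` E = set0.
      by apply/seteqP; split => // w [[Dw _] Ew]; apply: noD; exists w.
    have -> : D `&` E = set0.
      by apply/seteqP; split => // w [Dw Ew]; apply: noD; exists w.
    by rewrite pr_set0 mulr0.
  have ED : E `<=` D by move=> w Ew; apply: sD Dw0; rewrite Ew0 Ew.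
  have -> : D `&` E = E by apply/setIidr.
  have -> : (D `\` Z) `&` E = E `\` Z.
    apply/seteqP; split => w [] => [[Dw nZ] Ew|Ew nZ]; split => //; split => //.
    exact: ED.
  have Esplit : Pr E = Pr (E `\` Z) + Pr (E `&` Z).
    rewrite -prU ?setDUK//.
    - by rewrite setUC setUIDK.
    - exact: measurableD.
    - exact: measurableI.
    - by apply/seteqP; split => // w [[_ nZ] [_ /nZ]].
  suff : c1 * c2 * Pr E <= Pr (E `&` Z) by move: Esplit; lra.
  have [->|[bl [br [dl [dr [blN brN sE]]]]]] := past_state N x.
    by rewrite mulr0 pr_ge0.
  have [hr /HJ1 lo1] := stage_height K brN.
  have [hl /HJ2 lo2] := stage_height K blN.
  rewrite -/l in hr hl lo1 lo2; rewrite hr in sE.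
  have leL hi br' dr' E' : walk_state (- Posz N) hi bl br' dl dr' E' ->
      hit_left J2 `|bl - l|%N * Pr E' <=
      Pr (E' `&` [set w | run_left J2 (- Posz N) l w]).
    by rewrite {1}hl; exact: pr_run_left.
  have le := pr_run_right (measurable_left _ _ _) (hit_left_ge0 _ _) leL J1 sE.
  rewrite /Z setIA; apply: le_trans le.
  rewrite -mulrA; apply: ler_pM => //; rewrite ?(ltW c1_gt0)//.
    by rewrite mulr_ge0 ?pr_ge0 ?(ltW c2_gt0).
  by rewrite ler_wpM2r ?pr_ge0.
- move=> w st [[/= r1 r2] lw]; exact: (@runs_bridge N K l J1 J2).
Qed.

(** Stages repeated with errors [2^-1 * c * r ^+ j] leave probability at most [r ^+ j]
    for the absence of bridges after [j] stages. *)
Lemma no_bridge_negligible (M : nat) :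
  P.-negligible [set w | steps_pm w /\ ~ bridge_beyond M w].
Proof.
have [c /andP[c0 c1] stage] := bridge_stage.
pose r := 1 - 2^-1 * c.
have r0 : 0 < r by rewrite /r; lra.
have H j : exists N D, [/\ (M <= N)%N, saturated N D,
    [set w | steps_pm w /\ ~ bridge_beyond M w] `<=` D & Pr D <= r ^+ j].
  elim: j => [|j [N [D [MN sD BD prD]]]].
    by exists M, setT; split => //; rewrite pr_setT.
  have e0 : 0 < 2^-1 * c * r ^+ j by rewrite !mulr_gt0// exprn_gt0.
  have [N' [A [NN' sA DA Abr]]] := stage N _ e0.
  exists N', (D `\` A); split.
  - exact: leq_trans NN'.
  - move=> w w' e [Dw nA]; split; first exact: saturated_le NN' sD _ _ e Dw.
    by move=> Aw'; apply: nA; exact: sA (esym e) Aw'.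
  - move=> w [st nb]; split; first exact: BD.
    by move=> Aw; apply: nb; exact: bridge_beyond_le MN (Abr w st Aw).
  - apply: le_trans (DA D sD) _.
    have := ler_wpM2l (_ : 0 <= 1 - c) prD; rewrite subr_ge0 => /(_ c1).
    rewrite exprS /r; lra.
apply: pr_negligible => e e0.
have [j je] : exists j, r ^+ j <= e.
  have : r ^+ n @[n --> \oo] --> (0 : R).
    by apply: cvg_expr; rewrite ger0_norm ?(ltW r0)// /r; lra.
  move=> /cvgrPdist_le/(_ e e0)[n _ /(_ n (leqnn n))].
  by rewrite sub0r normrN ger0_norm ?exprn_ge0 ?(ltW r0)//; exists n.
have [N [D [_ sD BD prD]]] := H j; exists D; split => //.
  exact: saturated_measurable sD.
exact: le_trans prD je.
Qed.

Lemma no_left_down_negligible (M : nat) :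
  P.-negligible [set w | steps_pm w /\ forall i : int, i < - Posz M -> ~~ down i w].
Proof.
pose m := - Posz M.
have H j : exists E, [/\ cylinder (m - Posz j) m 0 0 E,
    [set w | steps_pm w /\ forall i : int, i < m -> ~~ down i w] `<=` E &
    Pr E <= (2^-1) ^+ j].
  elim: j => [|j [E [cE sub prE']]].
    by exists setT; split => //; [exact: cylinder_setT|rewrite pr_setT].
  pose i := m - Posz j.+1.
  have [| | | |||cE2 p2'] := @cylinder_cap (m - Posz j) m 0 0 (m - Posz j.+1) m 0 0
    E (inr i) [set w | step i w = 1] _ _ _ _ cE (step_event _ _);
    rewrite /= /i; try lia.
  exists (E `&` [set w | step i w = 1]); split => //.
    move=> w [st nd]; split; first exact: sub.
    have := st i; rewrite !inE => /orP[/eqP e|/eqP//].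
    by have := nd i; rewrite down_stepE e eqxx /i => /(_ ltac:(lia)).
  by rewrite p2' pr_step// exprSr ler_wpM2r.
apply: pr_negligible => e e0.
have [j je] : exists j, (2^-1) ^+ j <= e.
  have : (2^-1 : R) ^+ n @[n --> \oo] --> (0 : R).
    by apply: cvg_expr; rewrite ger0_norm//; lra.
  move=> /cvgrPdist_le/(_ e e0)[n _ /(_ n (leqnn n))].
  by rewrite sub0r normrN ger0_norm ?exprn_ge0//; exists n.
have [E [cE BE prE']] := H j; exists E; split => //.
  exact: cylinder_measurable cE.
exact: le_trans prE' je.
Qed.

Lemma ae_steps : {ae P, forall w, steps_pm w}.
Proof.
apply: ae_forall_countable => i.
exists (~` [set w | step i w \in [:: -1; 1]]).
have mS : measurable [set w | step i w \in [:: -1; 1]].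
  exact: discrete_step i [set x | x \in _].
split => //; first exact: measurableC.
rewrite probability_setC// prE//.
suff -> : Pr [set w | step i w \in [:: -1; 1]] = 1 by rewrite subee.
have mx y : measurable [set w | step i w = y] by exact: discrete_step i [set y].
have -> : [set w | step i w \in [:: -1; 1]] =
    [set w | step i w = -1] `|` [set w | step i w = 1].
  by apply/seteqP; split => w /=; rewrite !inE; [move=> /orP[]/eqP; [left|right]|
    case=> ->; rewrite eqxx ?orbT].
rewrite prU//; last by apply/seteqP; split => // w [/= ->]; lia.
by rewrite (@pr_step i (-1) isT) (@pr_step i 1 isT); lra.
Qed.

Lemma ae_displacements :
  {ae P, forall w, forall iu : int * seq nat, xi iu.1 iu.2 w \in [:: -1; 0; 1]}.
Proof.
apply: ae_forall_countable => -[i u] /=.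
exists (~` [set w | xi i u w \in [:: -1; 0; 1]]).
have mS (A : set int) : measurable [set w | A (xi i u w)] by exact: disp_rv enc i u A.
have mS3 := mS [set x | x \in [:: -1; 0; 1]].
split => //; first exact: measurableC.
rewrite probability_setC// prE//.
suff -> : Pr [set w | xi i u w \in [:: -1; 0; 1]] = 1 by rewrite subee.
have pr3 x : x \in [:: -1; 0; 1] -> Pr [set w | xi i u w = x] = 3^-1.
  by move=> x3; rewrite /pr (disp_law enc i u x3).
have mx y : measurable [set w | xi i u w = y] by exact: mS [set y].
have -> : [set w | xi i u w \in [:: -1; 0; 1]] =
    [set w | xi i u w = -1] `|` ([set w | xi i u w = 0] `|` [set w | xi i u w = 1]).
  apply/seteqP; split => w /=; rewrite !inE.
    by move=> /or3P[]/eqP; [left|right; left|right; right].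
  by move=> [|[]] ->; rewrite eqxx ?orbT.
rewrite !prU//.
- by rewrite (pr3 (-1) isT) (pr3 0 isT) (pr3 1 isT); lra.
- by apply/seteqP; split => // w [/= ->]; lia.
- exact: measurableU.
- by apply/seteqP; split => // w [/= ->] []; lia.
Qed.

Lemma uihpq_ae_recurrent :
  {ae P, forall w, srw_recurrent (uihpq (t ^~ w) (fun i u => xi i u w) (b ^~ w)) R}.
Proof.
have aeB : {ae P, forall w, forall M, steps_pm w -> bridge_beyond M w}.
  apply: ae_forall_countable => M.
  by apply: negligibleS (no_bridge_negligible M) => w /= /not_implyP.
have aeL : {ae P, forall w, forall M : nat, steps_pm w ->
    exists2 i : int, i < - Posz M & down i w}.
  apply: ae_forall_countable => M.
  apply: negligibleS (no_left_down_negligible M) => w /= /not_implyP[st nd].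
  by split => // i iM; apply/negP => di; apply: nd; exists i.
have aeS := ae_steps; have aeX := ae_displacements.
apply: filterS3 (filterI aeB aeL) aeS aeX => w [B L] S X.
apply: uihpq_recurrent.
- exact: walk0 enc w.
- by move=> i; exact: steps_pm_walk.
- by move=> m u; have := X (m, u); rewrite !inE => /or3P[]/eqP /= ->.
- by move=> N; exact: L.
- by move=> N; exact: B.
Qed.

End Encoding.

Theorem corollary2 (R : realType) (p : R) (hp0 : 0 <= p) (hp : p < 2^-1)
    (d : measure_display) (Omega : measurableType d) (P : probability Omega R)
    (t : int -> Omega -> ptree) (xi : int -> seq nat -> Omega -> int)
    (b : int -> Omega -> int) :
  uihpq_encoding p P t xi b ->
  {ae P, forall w,
    srw_recurrent (uihpq (t ^~ w) (fun i u => xi i u w) (b ^~ w)) R}.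
Proof. exact: uihpq_ae_recurrent. Qed.
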